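(* Let $u$ be a nonconstant inner function, and let $\varphi\in H^\infty$. The minimum modulus of the operator $B_\varphi:\mathcal{K}_u\to\mathcal{K}_u^\perp$ satisfies the following properties: (1) $m(B_\varphi)=m\left(T_{\overline{u}\varphi}|_{\mathcal{K}_u}\right)\ge m(T_{\overline{u}\varphi})$. (2) \[ m(B_\varphi)\ge\sqrt{\left(\operatorname*{ess\,inf}_{z\in\mathbb{T}}|\varphi(z)|\right)^2-\operatorname{dist}_{L^\infty}(\overline{u}\varphi,H^\infty)^2}. \] Furthermore, if $\varphi$ is an inner function, then \[ m(B_\varphi)=\sqrt{1-\operatorname{dist}_{L^\infty}(\overline{u}\varphi,H^\infty)^2}. \]
   Context: $L^2=L^2(\mathbb{T})$ with normalized Lebesgue measure on the unit circle $\mathbb{T}$; $H^2\subset L^2$ is the Hardy space, $P$ the orthogonal projection of $L^2$ onto $H^2$; $H^\infty=H^2\cap L^\infty(\mathbb{T})$ (boundary functions of bounded analytic functions on the unit disc). An inner function is $u\in H^\infty$ with $|u|=1$ a.e. on $\mathbb{T}$. The model space is $\mathcal{K}_u=H^2\ominus uH^2$, $\mathcal{K}_u^\perp$ is its orthogonal complement in $L^2$, with orthogonal projection $P_{\mathcal{K}_u^\perp}$. $B_\varphi f=P_{\mathcal{K}_u^\perp}(\varphi f)$ for $f\in\mathcal{K}_u$. For $\psi\in L^\infty(\mathbb{T})$ the Toeplitz operator $T_\psi:H^2\to H^2$ is $T_\psi f=P(\psi f)$. $\operatorname{dist}_{L^\infty}(\psi,H^\infty)=\inf_{h\in H^\infty}\|\psi-h\|_\infty$.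 For a bounded operator $T$ between Hilbert spaces, $m(T)=\inf\{\|Tx\|:\|x\|=1\}$, the infimum being over unit vectors of the domain of $T$ (so over $\mathcal{K}_u$ for $T_{\overline{u}\varphi}|_{\mathcal{K}_u}$). *)

(* Defs.v *)
From mathcomp Require Import all_boot all_order all_algebra.
From mathcomp Require Import complex.
From mathcomp Require Import all_classical all_reals all_analysis ess_sup_inf.
Import Order.TTheory GRing.Theory Num.Theory.
Import numFieldNormedType.Exports.

Set Implicit Arguments.
Unset Strict Implicit.
Unset Printing Implicit Defensive.

Local Open Scope classical_set_scope.
Local Open Scope ring_scope.
Local Open Scope complex_scope.

Section CircleFunctions.
Variable R : realType.

Lemma twopi_gt0 : (0 : R) < 2 * pi.
Proof. by rewrite mulr_gt0// pi_gt0. Qed.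

(* The circle is parametrized by theta |-> e^(i theta), 0 <= theta <= 2 pi, so
   that normalized Lebesgue measure on it is d theta / (2 pi) on [0, 2 pi].
   Functions on the circle are functions of theta; their values outside
   [0, 2 pi] lie on a null set. Elements of L^2 are represented by functions
   rather than by classes modulo a.e. equality. *)
Definition circle_measure : probability (measurableTypeR R) R :=
  uniform_prob twopi_gt0.

Local Notation m := circle_measure.

Definition cfun : Type := measurableTypeR R -> R[i].

Definition cmodulus (f : cfun) : measurableTypeR R -> \bar R :=
  fun t => (ComplexField.Normc.normc (f t))%:E.

Definition cmul (f g : cfun) : cfun := fun t => f t * g t.
Definition csub (f g : cfun) : cfun := fun t => f t - g t.
Definition cconj (f : cfun) : cfun := fun t => conjc (f t).

Definition cmeasurable (f : cfun) : Prop :=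
  measurable_fun setT (fun t => complex.Re (f t)) /\
  measurable_fun setT (fun t => complex.Im (f t)).

Definition cintegral (f : cfun) : R[i] :=
  (\int[m]_t complex.Re (f t)) +i* (\int[m]_t complex.Im (f t)).

Definition Lp (p : \bar R) : set cfun :=
  [set f | cmeasurable f /\ ('N[m]_p[cmodulus f] < +oo)%E].

Definition L2 : set cfun := Lp 2%:E.
Definition Linfty : set cfun := Lp +oo%E.

Definition norm2 (f : cfun) : R := fine ('N[m]_2%:E[cmodulus f]).
Definition norm_infty (f : cfun) : R := fine ('N[m]_+oo[cmodulus f]).

Definition essinf_modulus (f : cfun) : R := fine (ess_inf m (cmodulus f)).

Definition inner_prod (f g : cfun) : R[i] := cintegral (cmul f (cconj g)).

Definition monomial (n : int) : cfun :=
  fun t => cos (n%:~R * t) +i* sin (n%:~R * t).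

Definition fourier_coef (f : cfun) (n : int) : R[i] := inner_prod f (monomial n).

Definition H2 : set cfun :=
  [set f | L2 f /\ forall n : int, n < 0 -> fourier_coef f n = 0].

Definition Hinfty : set cfun := H2 `&` Linfty.

Definition is_inner_function (u : cfun) : Prop :=
  Hinfty u /\ {ae m, forall t, ComplexField.Normc.normc (u t) = 1}.

Definition nonconstant (u : cfun) : Prop :=
  ~ exists c : R[i], {ae m, forall t, u t = c}.

Definition ominus (E F : set cfun) : set cfun :=
  [set f | E f /\ forall g, F g -> inner_prod f g = 0].

Definition model_space (u : cfun) : set cfun := ominus H2 [set cmul u h | h in H2].

Definition model_space_perp (u : cfun) : set cfun := ominus L2 (model_space u).

(* Orthogonal projection of f onto the closed subspace E of L^2: a chosen
   representative of the (a.e. unique) g in E with f - g orthogonal to E;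
   the default value 0 is irrelevant when E is a closed subspace and f in L^2. *)
Definition proj (E : set cfun) (f : cfun) : cfun :=
  xget (fun=> 0 : R[i])
    [set g | E g /\ forall h, E h -> inner_prod (csub f g) h = 0].

Definition toeplitz (psi f : cfun) : cfun := proj H2 (cmul psi f).

Definition B_op (u phi f : cfun) : cfun :=
  proj (model_space_perp u) (cmul phi f).

(* Minimum modulus of the operator A with domain D. *)
Definition minmod (D : set cfun) (A : cfun -> cfun) : R :=
  inf [set norm2 (A f) | f in [set f | D f /\ norm2 f = 1]].

Definition dist_Hinfty (psi : cfun) : R :=
  inf [set norm_infty (csub psi h) | h in Hinfty].

End CircleFunctions.

(* Main.v *)
(** For [f] in the model space, [B_phi f] is the component [u P(conj u phi f)]
    of [phi f] in [u H^2], which gives (1), while the complementary component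
    has the norm of [(1 - P)(psi f)], [psi = conj u phi], so that
    [|B f|^2 = |phi f|^2 - |(1 - P)(psi f)|^2].  The Hankel operator
    [f |-> (1 - P)(psi f)] vanishes on [u H^2] and is bounded by the distance
    of [psi] to [H^infty], hence (2).  The equality for inner [phi] is Nehari's
    theorem: a Hankel form bounded by [rho] has a symbol bounded by [rho].

    Nehari's theorem is proved by extending the Hankel form one Fourier
    coefficient at a time without increasing its bound.  The new coefficient is
    a corner entry in the sense of Parrott; it is the limit of a linear
    functional along a minimising sequence of a quadratic form, so that no
    functional calculus is needed.  The coefficients found in this way are
    square summable, and the resulting symbol [g] satisfies
    [|int g |p|^2| <= rho int |p|^2] for all trigonometric polynomials [p].

    This implies [|g| <= rho] a.e.: the kernels [(1 - s^n)^(k^n)], with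
    [s] proportional to [1 - cos(t - x0)], converge boundedly to indicators of
    arcs centred at [x0], and Lebesgue's differentiation theorem applies.  The
    case [rho = 0] is the completeness of the trigonometric system. *)

Require Import Defs.
From HB Require Import structures.
From mathcomp Require Import all_boot all_order all_algebra.
From mathcomp Require Import complex ring lra zify.
From mathcomp Require Import all_classical all_reals all_analysis ess_sup_inf measurable_realfun.
Import Order.TTheory GRing.Theory Num.Theory.
Import numFieldNormedType.Exports.

Set Implicit Arguments.
Unset Strict Implicit.
Unset Printing Implicit Defensive.

Local Open Scope classical_set_scope.
Local Open Scope ring_scope.
Local Open Scope complex_scope.

(** For inner [phi] the symbol psi is unimodular, so a lower bound m for |P(psi f)| on unit vectors
    of K_u is the upper bound sqrt(1 - m^2) for the Hankel form on K_u. It extends to H^2 = K_u + u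
    H^2 because psi u h = phi h has no negative frequencies. In this way a quantity seen only on the
    model space reaches Nehari's theorem, which needs all of H^2.

    The symbol is obtained only as an L^2 limit, so its boundedness has to be recovered from the
    forms. Two shifts of one trigonometric polynomial p, one into H^2 and one into its complement,
    are admissible test vectors; they give access to integrals against |p|^2 and to nothing else.
    Hence arcs are approximated by squares of real polynomials in cos(t - x0). The kernels are of
    the kind used in elementary proofs of the Stone-Weierstrass theorem.

    As L^2 consists of functions, its inner product is only semidefinite: identities valid a.e.
    appear as the vanishing of the seminorm of a difference, and projections are unique in that
    sense only. *)

Section nsq.
Variable R : realType.
Implicit Types z w : R[i].

(** The squared modulus as a real number, free of square roots, so that estimates become polynomial
    identities and inequalities. *)
Definition nsq z : R := complex.Re z ^+ 2 + complex.Im z ^+ 2.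

Lemma nsq_ge0 z : 0 <= nsq z. Proof. by rewrite addr_ge0// sqr_ge0. Qed.

Lemma nsqM z w : nsq (z * w) = nsq z * nsq w.
Proof. by case: z w => a b [c d]; rewrite /nsq/=; ring. Qed.

Lemma nsqN z : nsq (- z) = nsq z.
Proof. by case: z => a b; rewrite /nsq/= !sqrrN. Qed.

Lemma conjcM z w : conjc (z * w) = conjc z * conjc w.
Proof. exact: rmorphM. Qed.

Lemma nsqJ z : z * conjc z = (nsq z)%:C.
Proof. by case: z => a b; rewrite /nsq; apply/eqP; rewrite eq_complex/=; apply/andP; split; apply/eqP; ring. Qed.

Lemma nsq_eq0 z : nsq z = 0 -> z = 0.
Proof.
case: z => a b /eqP; rewrite /nsq/= paddr_eq0 ?sqr_ge0// !sqrf_eq0.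
by move=> /andP[/eqP -> /eqP ->].
Qed.

Lemma nsqR (x : R) : nsq x%:C = x ^+ 2.
Proof. by rewrite /nsq/= expr0n addr0. Qed.

Lemma Re_le_nsq z : complex.Re z ^+ 2 <= nsq z.
Proof. by rewrite lerDl sqr_ge0. Qed.

Lemma Im_le_nsq z : complex.Im z ^+ 2 <= nsq z.
Proof. by rewrite lerDr sqr_ge0. Qed.

Lemma ReD z w : complex.Re (z + w) = complex.Re z + complex.Re w.
Proof. by case: z; case: w. Qed.

Lemma ReN z : complex.Re (- z) = - complex.Re z.
Proof. by case: z. Qed.

Lemma ReB z w : complex.Re (z - w) = complex.Re z - complex.Re w.
Proof. by case: z; case: w. Qed.

Lemma ImB z w : complex.Im (z - w) = complex.Im z - complex.Im w.
Proof. by case: z; case: w. Qed.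

Lemma ReC z : complex.Re (conjc z) = complex.Re z.
Proof. by case: z. Qed.

End nsq.

(** * Localising kernels *)

Lemma bernoulli_ge (R : realType) (x : R) (n : nat) :
  0 <= x <= 1 -> 1 - n%:R * x <= (1 - x) ^+ n.
Proof.
move=> /andP[x0 x1]; elim: n => [|n IHn]; first by rewrite mul0r subr0 expr0.
rewrite exprS -natr1.
have h : (1 - x) * (1 - n%:R * x) <= (1 - x) * (1 - x) ^+ n.
  by rewrite ler_wpM2l ?subr_ge0.
have : 0 <= n%:R * x ^+ 2 by rewrite mulr_ge0 ?exprn_ge0.
rewrite expr2; nra.
Qed.

Lemma bernoulli_prod_le1 (R : realType) (x : R) (n : nat) :
  0 <= x <= 1 -> (1 - x) ^+ n * (1 + n%:R * x) <= 1.
Proof.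
move=> /andP[x0 x1]; elim: n => [|n IHn]; first by rewrite mul0r addr0 expr0 mulr1.
apply: le_trans IHn; rewrite exprSr -mulrA ler_wpM2l ?exprn_ge0 ?subr_ge0//.
rewrite -natr1.
have : 0 <= n%:R * x ^+ 2 by rewrite mulr_ge0 ?exprn_ge0.
rewrite expr2; nra.
Qed.

(** Bernoulli bounds the power below by 1 - (k y)^n. The threshold 1 / k is sharp: see [step_cvg0]
    for the other side. *)
Lemma step_cvg1 (R : realType) (k : nat) (y : R) : 0 <= y <= 1 ->
  k%:R * y < 1 -> (1 - y ^+ n) ^+ (k ^ n) @[n --> \oo] --> (1 : R).
Proof.
move=> /andP[y0 y1] ky; apply: (@squeeze_cvgr _ _ _ _ (fun n => 1 - (k%:R * y) ^+ n) (fun=> 1)).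
- near=> n; apply/andP; split.
    rewrite exprMn -natrX; apply: bernoulli_ge.
    by rewrite exprn_ge0// exprn_ile1.
  by rewrite exprn_ile1// ?subr_ge0 ?exprn_ile1// lerBlDr lerDl exprn_ge0.
- rewrite -[X in _ --> X]subr0; apply: cvgB; first exact: cvg_cst.
  by apply: cvg_expr; rewrite ger0_norm ?mulr_ge0.
- exact: cvg_cst.
Unshelve. all: by end_near. Qed.

(** The product form of Bernoulli's inequality bounds the power by 1 / (1 + (k y)^n), hence by (k
    y)^-n. *)
Lemma step_cvg0 (R : realType) (k : nat) (y : R) : 0 <= y <= 1 ->
  1 < k%:R * y -> (1 - y ^+ n) ^+ (k ^ n) @[n --> \oo] --> (0 : R).
Proof.
move=> /andP[y0 y1] ky; have ky0 : 0 < k%:R * y by apply: lt_trans ky.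
apply: (@squeeze_cvgr _ _ _ _ (fun=> 0) (fun n => (k%:R * y)^-1 ^+ n)).
- near=> n; apply/andP; split.
    by rewrite exprn_ge0// subr_ge0 exprn_ile1.
  have h : 0 <= y ^+ n <= 1 by rewrite exprn_ge0//= exprn_ile1.
  have := bernoulli_prod_le1 (k ^ n) h.
  rewrite exprVn natrX -exprMn => h2.
  rewrite -[leRHS]mul1r ler_pdivlMr ?exprn_gt0//; apply: le_trans h2.
  by rewrite ler_wpM2l ?exprn_ge0 ?subr_ge0 ?exprn_ile1// lerDr.
- exact: cvg_cst.
- by apply: cvg_expr; rewrite ger0_norm ?invr_ge0 ?ltW// invf_lt1.
Unshelve. all: by end_near. Qed.

(* The kernel whose square tends, as n grows, to the indicator of the arc of
   half-width [d] centred at [x0] when [k * a * (1 - cos d) = 1]. *)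
Definition kern (R : realType) (a x0 : R) (k n : nat) (t : R) : R :=
  (1 - (a * (1 - cos (t - x0))) ^+ n) ^+ (k ^ n).

Lemma kern_bound (R : realType) (a x0 : R) k n t : 0 <= a -> a * 2 <= 1 ->
  0 <= kern a x0 k n t <= 1.
Proof.
move=> a0 a1; have := cos_geN1 (t - x0); have := cos_le1 (t - x0).
set c := cos _ => c1 cN1.
have y : 0 <= (a * (1 - c)) <= 1.
  rewrite mulr_ge0 ?subr_ge0//=; apply: le_trans a1; rewrite ler_wpM2l//; lra.
have /andP[y0 y1] := y.
have z : 0 <= 1 - (a * (1 - c)) ^+ n <= 1.
  by rewrite subr_ge0 exprn_ile1//= lerBlDr lerDl exprn_ge0.
have /andP[z0 z1] := z.
by rewrite /kern exprn_ge0//= exprn_ile1.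
Qed.

Lemma cos_lt_arc (R : realType) (x0 d t : R) : 0 < d -> d < x0 -> x0 + d < 2 * pi ->
  d < pi -> 0 <= t <= 2 * pi ->
  (`|t - x0| < d -> cos d < cos (t - x0)) /\ (d < `|t - x0| -> cos (t - x0) < cos d).
Proof.
move=> d0 dx xd dpi /andP[t0 t1].
have cabs : cos (t - x0) = cos `|t - x0|.
  by case: (ger0P (t - x0)) => // _; rewrite cosN.
have a0 := normr_ge0 (t - x0); rewrite cabs; split => h.
  by rewrite ltr_cos// in_itv/=; apply/andP; split; lra.
case: (lerP `|t - x0| pi) => hp.
  by rewrite ltr_cos// in_itv/=; apply/andP; split; lra.
(* Beyond pi the cosine increases again. Reflecting to 2 pi - |t - x0| returns to [0, pi], and the
   reflected distance still exceeds d because the arc lies inside (0, 2 pi). *)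
have a2 : `|t - x0| < 2 * pi - d.
  by case: (ger0P (t - x0)) => _; lra.
have -> : cos `|t - x0| = cos (2 * pi - `|t - x0|).
  by rewrite -[LHS]cosN -[LHS]cosD2pi mulr2n; congr cos; lra.
rewrite ltr_cos; first lra.
all: by rewrite in_itv/=; apply/andP; split; lra.
Qed.

Lemma kern_cvg (R : realType) (a x0 d t : R) k : 0 < d -> d < x0 -> x0 + d < 2 * pi ->
  d < pi -> 0 <= a -> a * 2 <= 1 -> k%:R * a * (1 - cos d) = 1 -> 0 <= t <= 2 * pi ->
  `|t - x0| != d ->
  kern a x0 k n t ^+ 2 @[n --> \oo] --> (if `|t - x0| < d then 1 else 0 : R).
Proof.
move=> d0 dx xd dpi a0 a1 ka tI td.
have [h1 h2] := cos_lt_arc d0 dx xd dpi tI.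
have := cos_geN1 (t - x0); have := cos_le1 (t - x0).
have a_gt0 : 0 < k%:R * a.
  rewrite lt_neqAle mulr_ge0// andbT; apply/eqP => e.
  by move: ka; rewrite -e mul0r => /esym/eqP; rewrite oner_eq0.
move=> c1 cN1.
have y : 0 <= (a * (1 - cos (t - x0))) <= 1.
  rewrite mulr_ge0 ?subr_ge0//=; apply: le_trans a1; rewrite ler_wpM2l//; lra.
case: ltrP => h.
  rewrite -[X in _ --> X]mulr1; under eq_fun do rewrite expr2.
  have : k%:R * (a * (1 - cos (t - x0))) < 1.
    by rewrite -[ltRHS]ka mulrA ltr_pM2l// ltrD2l ltrN2 h1.
  by move=> /(step_cvg1 y) c; apply: cvgM.
rewrite -[X in _ --> X](mulr0 0); under eq_fun do rewrite expr2.
have : 1 < k%:R * (a * (1 - cos (t - x0))).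
  by rewrite -[ltLHS]ka mulrA ltr_pM2l// ltrD2l ltrN2 h2// lt_neqAle eq_sym td.
by move=> /(step_cvg0 y) c; apply: cvgM.
Qed.

Lemma measurable_kern (R : realType) (a x0 : R) k n :
  measurable_fun [set: measurableTypeR R] (kern a x0 k n).
Proof.
rewrite /kern; apply: measurable_funX; apply: measurable_funB => //.
apply: measurable_funX; apply: measurable_funM => //.
apply: measurable_funB => //; apply: measurableT_comp.
  by apply: continuous_measurable_fun; exact: continuous_cos.
exact: measurable_funB.
Qed.

(** * Averages over arcs as limits of kernel integrals *)

Section localization.
Variable R : realType.
Notation mu := (@lebesgue_measure R).
Notation D := (`[0, 2 * pi]%classic : set (measurableTypeR R)).

Lemma ball_sub_circle (x0 d : R) : d < x0 -> x0 + d < 2 * pi -> ball x0 d `<=` D.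
Proof.
move=> dx xd t; rewrite /ball/= ltr_distlC => /andP[h1 h2].
by rewrite in_itv/=; apply/andP; split; lra.
Qed.

Lemma kern_dct (g : measurableTypeR R -> R) (a x0 d : R) (k : nat) :
  0 < d -> d < x0 -> x0 + d < 2 * pi -> d < pi -> 0 <= a -> a * 2 <= 1 ->
  k%:R * a * (1 - cos d) = 1 -> mu.-integrable D (EFin \o g) ->
  \int[mu]_(t in D) (g t * kern a x0 k n t ^+ 2) @[n --> \oo] -->
  \int[mu]_(t in ball x0 d) g t.
Proof.
move=> d0 dx xd dpi a0 a1 ka ig.
have mD : measurable (D : set (measurableTypeR R)) by [].
have bD := ball_sub_circle dx xd.
have mg : measurable_fun D g by apply/measurable_EFinP; case/integrableP: ig.
have mb : measurable (ball x0 d : set (measurableTypeR R)) by exact: measurable_ball.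
have mk n : measurable_fun D (fun t : measurableTypeR R => kern a x0 k n t ^+ 2).
  by apply: measurable_funX; apply: measurable_funTS; exact: measurable_kern.
have [] := @dominated_convergence _ _ _ mu D mD
  (fun n t => (g t * kern a x0 k n t ^+ 2)%:E)
  (fun t => ((g \_ (ball x0 d)) t)%:E) (fun t => `|(g t)%:E|%E).
- by move=> n; apply/measurable_EFinP; exact: measurable_funM.
- apply/measurable_EFinP/measurable_restrict => //.
  apply: measurable_funS mg => //; exact: subIsetl.
(* At the two ends of the arc the kernel sits exactly at its threshold; these points are the
   exceptional null set. *)
- exists [set x0 - d; x0 + d]; split.
  + by apply: measurableU; exact: measurable_set1.
  + apply/eqP; rewrite -measure_le0 (le_trans (measureU2 _ _ _))//= ?measurable_set1//.
    by rewrite !lebesgue_measure_set1 adde0.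
  + move=> t /=; apply: contra_notP => /not_orP[h1 h2] Dt.
    apply/cvg_EFin; first by near=> n.
    have td : `|t - x0| != d.
      by apply/eqP; case: (ger0P (t - x0)) => _ e; [apply: h2|apply: h1]; lra.
    have tI : 0 <= t <= 2 * pi by move: Dt; rewrite /= in_itv.
    have := @cvgMl_tmp _ _ _ _ _ (g t) _ (kern_cvg d0 dx xd dpi a0 a1 ka tI td); rewrite /comp patchE.
    have -> : (t \in (ball x0 d : set (measurableTypeR R))) = (`|t - x0| < d).
      by apply/idP/idP; rewrite inE /ball/= distrC.
    by case: ifP => _; rewrite ?mulr1 ?mulr0; apply.
- exact: (integrable_abse ig).
- apply: aeW => t n Dt.
  rewrite lee_fin normrM ler_piMr//.
  have /andP[k0 k1] := kern_bound x0 k n t a0 a1.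
  by rewrite ger0_norm; [exact: exprn_ile1|exact: exprn_ge0].
move=> ig' _ h; rewrite [X in _ --> X](_ : _ = fine (\int[mu]_(t in D) ((g \_ (ball x0 d)) t)%:E)); last first.
  rewrite /Rintegral -[in LHS](setIidr bD) integral_mkcondr; congr fine.
  by apply: eq_integral => t _; rewrite restrict_EFin.
apply: fine_cvg => //; rewrite fineK//.
exact: integrable_fin_num.
Unshelve. all: by end_near. Qed.

Lemma circle_lty : (mu D < +oo)%E.
Proof. by rewrite lebesgue_measure_itv/=; case: ifP; rewrite ?ltry. Qed.

Lemma integrable_circle_cst (c : R) : mu.-integrable D (EFin \o (fun=> c)).
Proof.
apply: measurable_bounded_integrable => //; first exact: circle_lty.
by exists `|c|; split => // M /ltW M1 t _.
Qed.

Lemma arc_average_le (g : measurableTypeR R -> R) (rho x0 d : R) :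
  0 < d -> d < x0 -> x0 + d < 2 * pi -> d < pi ->
  mu.-integrable D (EFin \o g) ->
  (forall a k n, 0 <= a -> a * 2 <= 1 -> \int[mu]_(t in D) (g t * kern a x0 k n t ^+ 2) <=
     rho * \int[mu]_(t in D) (1 * kern a x0 k n t ^+ 2)) ->
  \int[mu]_(t in ball x0 d) g t <= rho * (d *+ 2).
Proof.
move=> d0 dx xd dpi ig H.
have c1 : cos d < 1 by rewrite -cos0 ltr_cos// in_itv/= ?lexx ?pi_ge0// !ltW.
have cc : 0 < 1 - cos d by rewrite subr_gt0.
(* The threshold is to fall at distance d, which forces a = 1 / (k (1 - cos d)). Since 1 - cos takes
   values up to 2, a <= 1/2 is needed as well, and this is what the size of [k] ensures. *)
pose k := (Num.truncn (2 / (1 - cos d))).+1.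
have kgt : 2 / (1 - cos d) < k%:R by exact: truncnS_gt.
have k0 : 0 < k%:R * (1 - cos d) by rewrite mulr_gt0.
pose a := (k%:R * (1 - cos d))^-1.
have a0 : 0 <= a by rewrite invr_ge0 ltW.
have a1 : a * 2 <= 1.
  by rewrite mulrC ler_pdivrMr// mul1r; move: kgt; rewrite ltr_pdivrMr// => /ltW.
have ka : k%:R * a * (1 - cos d) = 1.
  by rewrite mulrAC mulfV// gt_eqF.
have i1 : mu.-integrable D (EFin \o (fun=> 1)) by exact: integrable_circle_cst.
have -> : d *+ 2 = \int[mu]_(t in ball x0 d) 1.
  rewrite Rintegral_cst; last exact: measurable_ball.
  by rewrite mul1r -[LHS]/(fine (d *+ 2)%:E) -(lebesgue_measure_ball x0 (ltW d0)).
have h1 := kern_dct d0 dx xd dpi a0 a1 ka ig.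
have h2 := kern_dct d0 dx xd dpi a0 a1 ka i1.
apply: (ler_cvg_to h1 (@cvgMl_tmp _ _ _ _ _ rho _ h2)).
by near=> n; apply: H.
Unshelve. all: by end_near. Qed.
End localization.

(** * The circle measure and Lebesgue differentiation *)

Section circle.
Variable R : realType.
Notation mu := (@lebesgue_measure R).
Notation D := (`[0, 2 * pi]%classic : set (measurableTypeR R)).
Notation m := (circle_measure R).

Lemma ge0_integral_circle (f : measurableTypeR R -> \bar R) :
  measurable_fun setT f -> (forall t, 0 <= f t)%E ->
  (\int[m]_t f t = (2 * pi)^-1%:E * \int[mu]_(t in D) f t)%E.
Proof.
by move=> mf f0; rewrite [LHS](integral_uniform (twopi_gt0 R) mf f0) subr0.
Qed.

Lemma integrable_circle (f : measurableTypeR R -> \bar R) :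
  m.-integrable setT f -> mu.-integrable D f.
Proof.
move=> /integrableP[mf foo]; apply/integrableP; split.
  exact: measurable_funTS.
move: foo; rewrite ge0_integral_circle//; last exact: measurableT_comp.
move=> foo; rewrite -[ltLHS]mul1e.
have -> : (1 = (2 * pi)%:E * ((2 * pi)^-1)%:E :> \bar R)%E.
  by rewrite -EFinM mulfV// gt_eqF// twopi_gt0.
rewrite -muleA lte_mul_pinfty// ?lee_fin ?ltW ?twopi_gt0//.
Qed.

Lemma integral_circle (f : measurableTypeR R -> \bar R) :
  m.-integrable setT f -> 
  (\int[m]_t f t = (2 * pi)^-1%:E * \int[mu]_(t in D) f t)%E.
Proof.
move=> fi; have [mf _] := integrableP _ _ _ fi; have fi' := integrable_circle fi.
rewrite (integralE m setT f) (integralE mu D f).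
rewrite (ge0_integral_circle (measurable_funepos mf))//.
rewrite (ge0_integral_circle (measurable_funeneg mf))//.
by rewrite [RHS]muleBr//; exact: integrable_add_def.
Qed.

Lemma Rintegral_circle (f : measurableTypeR R -> R) :
  m.-integrable setT (EFin \o f) -> 
  \int[m]_t f t = (2 * pi)^-1 * \int[mu]_(t in D) f t.
Proof.
move=> fi; rewrite /Rintegral integral_circle// fineM//.
by apply: integrable_fin_num => //; exact: integrable_circle.
Qed.

Lemma circle_null (N : set (measurableTypeR R)) :
  measurable N -> mu N = 0%E -> m N = 0%E.
Proof.
move=> mN N0.
have /null_content_dominatesP := dominates_uniform_prob (twopi_gt0 R).
exact.
Qed.

(** Only interior points of [0, 2 pi] are centres of small arcs inside it; the end points and the
    exterior are null for the circle measure. *)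
Lemma ae_circle (P : set (measurableTypeR R)) :
  {ae mu, forall t, 0 < t < 2 * pi -> P t} -> {ae m, forall t, P t}.
Proof.
move=> [N [mN N0 sN]].
have m1 (a : R) : measurable ([set a] : set (measurableTypeR R)) by exact: measurable_set1.
have m10 (a : R) : m [set a] = 0%E by exact/circle_null/lebesgue_measure_set1.
have mDC : measurable (~` D) by exact: measurableC.
exists (N `|` ~` D `|` ([set 0] `|` [set 2 * pi])); split.
- by repeat apply: measurableU.
- have hU : measurable (N `|` ~` D) by exact: measurableU.
  have h2 : measurable ([set 0] `|` [set 2 * pi] : set (measurableTypeR R)) by exact: measurableU.
  apply: null_set_setU => //; last first.
    by apply: null_set_setU; [exact: m1|exact: m1|exact: m10|exact: m10].
  apply: null_set_setU => //; first exact: circle_null.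
  rewrite -[LHS]/(uniform_prob _ _) /uniform_prob integral_uniform_pdf.
  by rewrite setICl integral_set0.
- move=> t /= nP; case: (boolP (t \in `[0, 2 * pi])) => tI; last by left; right; exact/negP.
  have [->|t0] := eqVneq t 0; first by right; left.
  have [->|t1] := eqVneq t (2 * pi); first by right; right.
  left; left; apply: sN => /= h; apply: nP; apply: h.
  by move: tI; rewrite in_itv/= !lt_neqAle eq_sym t0 t1.
Qed.

Lemma nicely_shrinking_ball (x : R) :
  nicely_shrinking x (fun n => ball x (n.+1%:R^-1)).
Proof.
split; first by move=> n; exact: measurable_ball.
have p n : (0 : R) < n.+1%:R^-1 by rewrite invr_gt0.
exists (1, fun n => PosNum (p n)); split; rewrite /= ?ltr01//.
- exact: cvg_harmonic.
- by move=> n; exact: subset_refl.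
- by move=> n; rewrite mul1e.
Qed.

Lemma ball_average_cvg (f : measurableTypeR R -> R) (x : R) :
  mu.-integrable D (EFin \o f) -> 0 < x < 2 * pi -> lebesgue_pt (f \_ D) x ->
  (n.+1%:R^-1 *+ 2)^-1 * \int[mu]_(t in ball x n.+1%:R^-1) f t @[n --> \oo] --> f x.
Proof.
move=> fi /andP[x0 x1] fx.
have xD : x \in (D : set (measurableTypeR R)) by rewrite inE/= in_itv/= !ltW.
have := nice_lebesgue_differentiation nicely_shrinking_ball
  (integrable_locally_restrict _ fi) fx => /(_ _)/fine_cvg.
rewrite patchE xD => h; apply: cvg_trans (h _) => //.
apply: near_eq_cvg; near=> n => /=.
have bD : ball x n.+1%:R^-1 `<=` D.
  apply: ball_sub_circle.
    by near: n; apply: (cvgr_lt 0) => //; exact: cvg_harmonic.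
  rewrite -ltrBrDl; near: n; apply: (cvgr_lt 0); first exact: cvg_harmonic.
  by rewrite subr_gt0.
rewrite (lebesgue_measure_ball x) ?invr_ge0// inver.
rewrite gt_eqF ?pmulrn_lgt0 ?invr_gt0//.
have -> : (\int[mu]_(t in ball x n.+1%:R^-1) ((f \_ D) t)%:E =
    \int[mu]_(t in ball x n.+1%:R^-1) (f t)%:E)%E.
  by apply: eq_integral => t; rewrite inE => /bD tD; rewrite patchE mem_set.
rewrite fineM//; apply: integrable_fin_num; first exact: measurable_ball.
by apply: integrableS fi => //; exact: measurable_ball.
Unshelve. all: by end_near. Qed.

Lemma integrable_kern (f : measurableTypeR R -> R) a x0 k n :
  0 <= a -> a * 2 <= 1 -> m.-integrable setT (EFin \o f) ->
  m.-integrable setT (EFin \o (fun t => f t * kern a x0 k n t ^+ 2)).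
Proof.
move=> a0 a1 fi; have mf : measurable_fun setT f by apply/measurable_EFinP; case/integrableP: fi.
apply: le_integrable fi => //.
  apply/measurable_EFinP; apply: measurable_funM => //.
  by apply: measurable_funX; exact: measurable_kern.
move=> t _ /=; have /andP[k0 k1] := kern_bound x0 k n t a0 a1.
rewrite lee_fin normrM ler_piMr// ger0_norm; [exact: exprn_ile1|exact: exprn_ge0].
Qed.

Lemma integrable_cst1 : m.-integrable setT (EFin \o (fun=> 1)).
Proof. exact: finite_measure_integrable_cst. Qed.

(** A bound on a modulus is a family of linear bounds, one for each real direction (w1, w2). Linear
    bounds survive averaging and differentiation. *)
Lemma ae_norm_le (f1 f2 : measurableTypeR R -> R) (rho : R) : 0 <= rho ->
  m.-integrable setT (EFin \o f1) -> m.-integrable setT (EFin \o f2) ->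
  (forall w1 w2 a x0 k n, 0 <= a -> a * 2 <= 1 ->
     \int[m]_t ((w1 * f1 t + w2 * f2 t) * kern a x0 k n t ^+ 2) <=
     rho * Num.sqrt (w1 ^+ 2 + w2 ^+ 2) * \int[m]_t (1 * kern a x0 k n t ^+ 2)) ->
  {ae m, forall t, Num.sqrt (f1 t ^+ 2 + f2 t ^+ 2) <= rho}.
Proof.
move=> rho0 i1 i2 H; apply: ae_circle.
have j1 := integrable_circle i1; have j2 := integrable_circle i2.
have mD : measurable (D : set (measurableTypeR R)) by [].
have iw w1 w2 : m.-integrable setT (EFin \o (fun t => w1 * f1 t + w2 * f2 t)).
  have := integrableD measurableT (integrableZl measurableT w1 i1)
     (integrableZl measurableT w2 i2).
  by apply: eq_integrable.
have H' w1 w2 x0 d : 0 < d -> d < x0 -> x0 + d < 2 * pi -> d < pi ->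
    w1 * \int[mu]_(t in ball x0 d) f1 t + w2 * \int[mu]_(t in ball x0 d) f2 t <=
    rho * Num.sqrt (w1 ^+ 2 + w2 ^+ 2) * (d *+ 2).
  move=> d0 dx xd dpi.
  have bD := ball_sub_circle dx xd.
  have mb : measurable (ball x0 d : set (measurableTypeR R)) by exact: measurable_ball.
  have b1 := integrableS mD mb bD j1; have b2 := integrableS mD mb bD j2.
  have := arc_average_le (rho := rho * Num.sqrt (w1 ^+ 2 + w2 ^+ 2)) d0 dx xd dpi (integrable_circle (iw w1 w2)) _.
  rewrite RintegralD//; [|exact: (integrableZl mb w1 b1)|exact: (integrableZl mb w2 b2)].
  rewrite !RintegralZl//; apply => a k n a0 a1.
  have := H w1 w2 a x0 k n a0 a1.
  rewrite !Rintegral_circle; [|exact: integrable_kern integrable_cst1|exact: integrable_kern].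
  by rewrite mulrCA ler_pM2l// invr_gt0 twopi_gt0.
have L1 := lebesgue_differentiation (integrable_locally_restrict mD j1).
have L2 := lebesgue_differentiation (integrable_locally_restrict mD j2).
apply: (@filterS2 _ _ (ae_filter_ringOfSetsType mu) _ _ _ _ L1 L2) => x l1 l2 xI.
have c1 := ball_average_cvg j1 xI l1; have c2 := ball_average_cvg j2 xI l2.
set W := Num.sqrt _; have /andP[x0 x1] := xI.
have W0 : 0 <= W by exact: sqrtr_ge0.
have WW : W ^+ 2 = f1 x ^+ 2 + f2 x ^+ 2 by rewrite sqr_sqrtr// addr_ge0// sqr_ge0.
(* The direction is chosen at the point itself, as (f1 x, f2 x): the averages then tend to W^2 while
   the right-hand side is rho W. *)
suff h : W ^+ 2 <= rho * W.
  have [W1|W1] := leP W 0; first exact: le_trans rho0.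
  by move: h; rewrite expr2 ler_pM2r.
rewrite WW; set l := f1 x ^+ 2 + _; rewrite -[leRHS]mulr1.
have hn e : 0 < e -> \forall n \near \oo, n.+1%:R^-1 < e :> R.
  by move=> e0; apply: (cvgr_lt 0) => //; exact: cvg_harmonic.
apply: (ler_cvg_to (cvgD (@cvgMl_tmp _ _ _ _ _ (f1 x) _ c1) (@cvgMl_tmp _ _ _ _ _ (f2 x) _ c2))).
  exact: cvg_cst.
near=> n => /=.
have p : 0 < n.+1%:R^-1 *+ 2 :> R by rewrite pmulrn_lgt0// invr_gt0.
rewrite mulr1 fctE /= !(mulrCA _ (n.+1%:R^-1 *+ 2)^-1) -mulrDr mulrC ler_pdivrMr//.
apply: H' => //.
- by near: n; exact: hn.
- by rewrite -ltrBrDl; near: n; apply: hn; rewrite subr_gt0.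
- by near: n; apply: hn; exact: pi_gt0.
Unshelve. all: by end_near. Qed.
End circle.

(** * The space L2 of the circle *)

Section L2.
Variable R : realType.
Notation mu := (@lebesgue_measure R).
Notation m := (circle_measure R).
Notation Re := (@complex.Re R).
Notation Im := (@complex.Im R).

Definition sqmod (f : cfun R) (t : measurableTypeR R) : R := nsq (f t).

Lemma sqmod_ge0 f t : 0 <= sqmod f t.
Proof. exact: nsq_ge0. Qed.

Lemma cmodulusE f t : cmodulus f t = (Num.sqrt (sqmod f t))%:E.
Proof. by rewrite /cmodulus /sqmod /nsq; case: (f t). Qed.

Lemma measurable_sqmod f : cmeasurable f -> measurable_fun setT (sqmod f).
Proof.
by move=> [mr mi]; apply: measurable_funD; apply: measurable_funX.
Qed.

Lemma Lnorm2_sqr f : ('N[m]_2%:E[cmodulus f] `^ 2 = \int[m]_t (sqmod f t)%:E)%E.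
Proof.
rewrite powR_Lnorm//; apply: eq_integral => t _.
rewrite cmodulusE gee0_abs ?lee_fin ?sqrtr_ge0//.
by rewrite poweR_EFin powR_mulrn ?sqrtr_ge0// sqr_sqrtr ?sqmod_ge0.
Qed.

Lemma L2P (f : cfun R) :
  L2 f <-> cmeasurable f /\ m.-integrable setT (EFin \o sqmod f).
Proof.
split=> [[mf fl]|[mf fi]]; split => //.
  apply/integrableP; split; first by apply/measurable_EFinP; exact: measurable_sqmod.
  under eq_integral do rewrite gee0_abs ?lee_fin ?sqmod_ge0//.
  by rewrite -Lnorm2_sqr poweR_lty.
have := integrable_fin_num measurableT fi; rewrite -Lnorm2_sqr fin_numElt.
by move=> /andP[_]; apply: lty_poweRy.
Qed.

Lemma norm2E (f : cfun R) : L2 f -> norm2 f ^+ 2 = \int[m]_t sqmod f t.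
Proof.
move=> [mf fl]; rewrite /norm2 /Rintegral -Lnorm2_sqr.
have N0 := Lnorm_ge0 m 2%:E (cmodulus f).
have fN : 'N[m]_2%:E[cmodulus f]%E \is a fin_num by rewrite ge0_fin_numE.
by rewrite -[in RHS](fineK fN) poweR_EFin /= powR_mulrn// fine_ge0.
Qed.

Lemma norm2_ge0 (f : cfun R) : 0 <= norm2 f.
Proof. by rewrite fine_ge0// Lnorm_ge0. Qed.

Definition cintegrable (f : cfun R) :=
  m.-integrable setT (EFin \o (fun t => Re (f t))) /\
  m.-integrable setT (EFin \o (fun t => Im (f t))).

Lemma cmeasurableD (f g : cfun R) : cmeasurable f -> cmeasurable g ->
  cmeasurable (fun t => f t + g t).
Proof.
move=> [f1 f2] [g1 g2]; split.
  rewrite (_ : (fun _ => _) = (fun t => Re (f t)) \+ (fun t => Re (g t))).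
    exact: measurable_funD.
  by apply/funext => t /=; case: (f t); case: (g t).
rewrite (_ : (fun _ => _) = (fun t => Im (f t)) \+ (fun t => Im (g t))).
  exact: measurable_funD.
by apply/funext => t /=; case: (f t); case: (g t).
Qed.

Lemma cmeasurable_cst (c : R[i]) : cmeasurable (fun=> c).
Proof. by split. Qed.

Lemma cmeasurable_conj (f : cfun R) : cmeasurable f -> cmeasurable (cconj f).
Proof.
move=> [f1 f2]; split.
  rewrite (_ : (fun _ => _) = (fun t => Re (f t)))//.
  by apply/funext => t; rewrite /cconj; case: (f t).
rewrite (_ : (fun _ => _) = (\- (fun t => Im (f t)))).
  exact: measurable_funN.
by apply/funext => t; rewrite /cconj/=; case: (f t).
Qed.

Lemma cmeasurableM (f g : cfun R) : cmeasurable f -> cmeasurable g ->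
  cmeasurable (cmul f g).
Proof.
move=> [f1 f2] [g1 g2]; split.
  rewrite (_ : (fun _ => _) = (fun t => Re (f t)) \* (fun t => Re (g t)) \-
    (fun t => Im (f t)) \* (fun t => Im (g t))).
    by apply: measurable_funB; apply: measurable_funM.
  by apply/funext => t; rewrite /cmul/=; case: (f t); case: (g t).
rewrite (_ : (fun _ => _) = (fun t => Re (f t)) \* (fun t => Im (g t)) \+
    (fun t => Im (f t)) \* (fun t => Re (g t))).
  by apply: measurable_funD; apply: measurable_funM.
by apply/funext => t; rewrite /cmul/=; case: (f t); case: (g t).
Qed.

Lemma cintegralD (f g : cfun R) : cintegrable f -> cintegrable g ->
  cintegral (fun t => f t + g t) = cintegral f + cintegral g.
Proof.
move=> [f1 f2] [g1 g2]; rewrite /cintegral -[RHS]/(_ +i* _); congr (_ +i* _).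
  rewrite -RintegralD//; apply: eq_Rintegral => t _.
  by case: (f t); case: (g t).
rewrite -RintegralD//; apply: eq_Rintegral => t _.
by case: (f t); case: (g t).
Qed.

Lemma cintegralZ (c : R[i]) (f : cfun R) : cintegrable f ->
  cintegral (fun t => c * f t) = c * cintegral f.
Proof.
case: c => a b [f1 f2]; rewrite /cintegral -[RHS]/(_ +i* _).
have Z (r : R) (g : measurableTypeR R -> R) : m.-integrable setT (EFin \o g) ->
   m.-integrable setT (EFin \o (fun t => r * g t)) by move=> gi; exact: (integrableZl measurableT r gi).
congr (_ +i* _); rewrite -!RintegralZl// -?RintegralB -?RintegralD//; try exact: Z.
  by apply: eq_Rintegral => t _; case: (f t).
by apply: eq_Rintegral => t _; case: (f t).
Qed.

Lemma cintegral_conj (f : cfun R) : cintegrable f ->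
  cintegral (cconj f) = conjc (cintegral f).
Proof.
move=> [f1 f2]; rewrite /cintegral /cconj/=; congr (_ +i* _).
  by apply: eq_Rintegral => t _; case: (f t).
rewrite -mulN1r -RintegralZl//; apply: eq_Rintegral => t _; rewrite mulN1r.
by case: (f t).
Qed.

Lemma integrable_sqmodD (f g : cfun R) : L2 f -> L2 g ->
  m.-integrable setT (EFin \o (fun t => sqmod f t + sqmod g t)).
Proof.
move=> /L2P[_ f2] /L2P[_ g2].
exact: (integrableD measurableT f2 g2).
Qed.

(** The real and imaginary parts of the product are dominated by |f|^2 + |g|^2; each of the four
    differences is half a sum of squares. *)
Lemma cintegrable_mul (f g : cfun R) : L2 f -> L2 g -> cintegrable (cmul f g).
Proof.
move=> Lf Lg; have := integrable_sqmodD Lf Lg.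
move: Lf Lg => /L2P[mf _] /L2P[mg _] fg; have [m1 m2] := cmeasurableM mf mg.
have h t : 0 <= sqmod f t + sqmod g t by rewrite addr_ge0// sqmod_ge0.
split; (apply: le_integrable fg => //; first exact/measurable_EFinP) => t _;
  rewrite lee_fin [leRHS](ger0_norm (h t)) /sqmod /nsq /cmul;
  case: (f t) => a b; case: (g t) => c d /=; rewrite ler_norml; apply/andP; split;
  rewrite -subr_ge0.
- rewrite (_ : _ - _ = ((a + c) ^+ 2 + (b - d) ^+ 2 + (a ^+ 2 + b ^+ 2 + c ^+ 2 + d ^+ 2)) / 2); last by field.
  by rewrite divr_ge0// !addr_ge0// sqr_ge0.
- rewrite (_ : _ - _ = ((a - c) ^+ 2 + (b + d) ^+ 2 + (a ^+ 2 + b ^+ 2 + c ^+ 2 + d ^+ 2)) / 2); last by field.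
  by rewrite divr_ge0// !addr_ge0// sqr_ge0.
- rewrite (_ : _ - _ = ((a + d) ^+ 2 + (b + c) ^+ 2 + (a ^+ 2 + b ^+ 2 + c ^+ 2 + d ^+ 2)) / 2); last by field.
  by rewrite divr_ge0// !addr_ge0// sqr_ge0.
- rewrite (_ : _ - _ = ((a - d) ^+ 2 + (b - c) ^+ 2 + (a ^+ 2 + b ^+ 2 + c ^+ 2 + d ^+ 2)) / 2); last by field.
  by rewrite divr_ge0// !addr_ge0// sqr_ge0.
Qed.

Lemma L2D (f g : cfun R) : L2 f -> L2 g -> L2 (fun t => f t + g t).
Proof.
move=> Lf Lg; have := integrable_sqmodD Lf Lg.
move: Lf Lg => /L2P[mf _] /L2P[mg _] fg; have mfg := cmeasurableD mf mg.
apply/L2P; split => //.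
have := integrableZl measurableT 2 fg; apply: le_integrable => //.
  by apply/measurable_EFinP; exact: measurable_sqmod.
move=> t _; have h0 : 0 <= sqmod f t + sqmod g t by rewrite addr_ge0// sqmod_ge0.
rewrite -EFinM !abse_EFin lee_fin !ger0_norm ?mulr_ge0// ?sqmod_ge0//; move: h0.
rewrite /sqmod /nsq; case: (f t) => a b; case: (g t) => c d /= _; rewrite -subr_ge0.
rewrite (_ : _ - _ = (a - c) ^+ 2 + (b - d) ^+ 2); last by ring.
by rewrite addr_ge0// sqr_ge0.
Qed.

Definition bounded_cfun (a : cfun R) := exists M : R, {ae m, forall t, sqmod a t <= M}.

Lemma L2M (a f : cfun R) : cmeasurable a -> bounded_cfun a -> L2 f -> L2 (cmul a f).
Proof.
move=> ma [M aM] /L2P[mf fi]; have maf := cmeasurableM ma mf.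
apply/L2P; split => //; apply/integrableP; split.
  by apply/measurable_EFinP; exact: measurable_sqmod.
have /integrableP[mM] := integrableZl measurableT M fi; apply: le_lt_trans.
apply: ae_ge0_le_integral => //=.
- by apply/measurable_EFinP; apply: measurableT_comp => //; exact: measurable_sqmod.
- by apply/measurable_EFinP; apply: measurableT_comp => //; apply/measurable_EFinP; exact: mM.
- apply: filterS aM => t aM _; rewrite lee_fin !ger0_norm ?sqmod_ge0//; last first.
    by rewrite mulr_ge0 ?sqmod_ge0// (le_trans _ aM)// sqmod_ge0.
  rewrite (_ : sqmod (cmul a f) t = sqmod a t * sqmod f t).
    by rewrite ler_wpM2r ?sqmod_ge0.
  by rewrite /sqmod /nsq /cmul; case: (a t) => ? ?; case: (f t) => ? ? /=; ring.
Qed.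

Lemma L2_cst (c : R[i]) : L2 (fun=> c).
Proof.
apply/L2P; split; first exact: cmeasurable_cst.
exact: finite_measure_integrable_cst.
Qed.

Lemma L2Z (c : R[i]) (f : cfun R) : L2 f -> L2 (fun t => c * f t).
Proof.
apply: L2M; first exact: cmeasurable_cst.
by exists (Re c ^+ 2 + Im c ^+ 2); apply: aeW => t; rewrite /sqmod /nsq.
Qed.

End L2.

(** * Completeness of L2 *)

Section riesz_fischer.
Variable R : realType.
Notation m := (circle_measure R).

Lemma cvgn_dominated_increments (g d : nat -> R) :
  (forall k, `|g k.+1 - g k| <= d k) -> (\sum_(0 <= k <oo) (d k)%:E < +oo)%E -> cvgn g.
Proof.
move=> gd dS.
have d0 k : 0 <= d k by apply: le_trans (gd k).
have S0 : (0 <= \sum_(0 <= k <oo) (d k)%:E)%E by apply: nneseries_ge0 => k _ _; rewrite lee_fin.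
have fS : (\sum_(0 <= k <oo) (d k)%:E)%E \is a fin_num by rewrite ge0_fin_numE.
have cd : cvgn (series d).
  apply: nondecreasing_is_cvgn.
    by apply: nondecreasing_series => k _ _.
  exists (fine (\sum_(0 <= k <oo) (d k)%:E)%E) => _ [k _ <-].
  rewrite -lee_fin fineK// seriesEnat/= -sumEFin.
  by apply: nneseries_lim_ge => j _ _; rewrite lee_fin.
have ct : cvgn (series (telescope g)).
  by apply: normed_cvg; apply: (series_le_cvg _ _ _ cd) => k //=; exact: gd.
rewrite (_ : g = (fun n => g 0%N + series (telescope g) n)); last first.
  by apply/funext => n; rewrite {1}(eq_sum_telescope g n).
by apply: is_cvgD => //; exact: is_cvg_cst.
Qed.

(** The upper limit is measurable whether or not the sequence converges, and [fine] makes it a real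
    function that agrees with the limit wherever there is one. *)
Lemma measurable_ae_limit (g : nat -> measurableTypeR R -> R) :
  (forall k, measurable_fun setT (g k)) ->
  exists2 h : measurableTypeR R -> R, measurable_fun setT h &
    forall t, cvgn (g ^~ t) -> g k t @[k --> \oo] --> h t.
Proof.
move=> mg; exists (fun t => fine (limn_esup (fun k => (g k t)%:E))).
  apply: measurableT_comp => //.
  by apply: (measurable_fun_limn_esup (f := fun k t => (g k t)%:E)) => k; exact/measurable_EFinP.
move=> t /cvg_ex[l gl].
have gl' : (g k t)%:E @[k --> \oo] --> l%:E by apply: cvg_EFin => //; exact: nearW.
by have [_ ->] := cvg_limn_einf_sup gl'.
Qed.

Lemma cmeasurableB (f g : cfun R) : cmeasurable f -> cmeasurable g ->
  cmeasurable (csub f g).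
Proof.
move=> mf mg; have := cmeasurableD mf (cmeasurableM (cmeasurable_cst (-1)) mg).
by congr cmeasurable; apply/funext => t; rewrite /csub /cmul mulN1r.
Qed.

Lemma L2B (f g : cfun R) : L2 f -> L2 g -> L2 (csub f g).
Proof.
move=> Lf Lg; have := L2D Lf (L2Z (-1) Lg).
by congr L2; apply/funext => t; rewrite /csub mulN1r.
Qed.

(** Extended-real, so that distances to a candidate limit make sense before the limit is known to
    lie in [L2]. *)
Definition sqdist (f g : cfun R) : \bar R := (\int[m]_t (sqmod (csub f g) t)%:E)%E.

(** AM-GM with a free weight. Integrated over a space of mass one, with [e] a bound for the L^2
    norm, it bounds the L^1 norm by [e] without Cauchy-Schwarz. *)
Lemma le_sqrt_weighted (x e : R) : 0 <= x -> 0 < e -> Num.sqrt x <= (x / e + e) / 2.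
Proof.
move=> x0 e0; rewrite -[in leRHS](sqr_sqrtr x0); set s := Num.sqrt x.
rewrite -subr_ge0 (_ : _ - _ = (s - e) ^+ 2 / (2 * e)); last by field; rewrite gt_eqF.
by rewrite divr_ge0 ?sqr_ge0// mulr_ge0// ltW.
Qed.

(** The L^1 norms of the increments are at most 2^-k, so the sum of the increments is integrable,
    hence finite a.e. *)
Lemma fast_cauchy_ae_cvg (f : nat -> cfun R) : (forall k, cmeasurable (f k)) ->
  (forall k, (sqdist (f k.+1) (f k) <= ((2^-1 ^+ k) ^+ 2)%:E)%E) ->
  {ae m, forall t, (\sum_(0 <= k <oo) (Num.sqrt (sqmod (csub (f k.+1) (f k)) t))%:E < +oo)%E}.
Proof.
move=> mf fd; pose d k t := Num.sqrt (sqmod (csub (f k.+1) (f k)) t).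
have md k : measurable_fun setT (d k).
  apply: measurableT_comp; last by apply: measurable_sqmod; exact: cmeasurableB.
  by apply: continuous_measurable_fun; exact: sqrt_continuous.
have d0 k t : (0 <= (d k t)%:E)%E by rewrite lee_fin sqrtr_ge0.
have Id k : (\int[m]_t (d k t)%:E <= (2^-1 ^+ k)%:E)%E.
  pose e : R := 2^-1 ^+ k; have e0 : 0 < e by rewrite exprn_gt0.
  apply: (@le_trans _ _ (\int[m]_t ((2 * e)^-1%:E * (sqmod (csub (f k.+1) (f k)) t)%:E + (e / 2)%:E)))%E.
    apply: ge0_le_integral => //.
    - exact/measurable_EFinP.
    - apply/measurable_EFinP; apply: measurable_funD => //; apply: measurable_funM => //.
      by apply: measurable_sqmod; exact: cmeasurableB.
    - move=> t _; rewrite -EFinM -EFinD lee_fin.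
      apply: le_trans (le_sqrt_weighted (sqmod_ge0 _ _) e0) _.
      rewrite le_eqVlt; apply/orP; left; apply/eqP; field; exact: lt0r_neq0.
  rewrite ge0_integralD//.
  - rewrite ge0_integralZl//.
    + rewrite integral_cst// [X in (_ + _ * X <= _)%E](_ : _ = 1%E) ?mule1; last exact: probability_setT.
      apply: (@le_trans _ _ ((2 * e)^-1%:E * (e ^+ 2)%:E + (e / 2)%:E))%E.
        apply: leeD2r; apply: lee_wpmul2l; last exact: fd.
        by rewrite lee_fin invr_ge0 mulr_ge0// ltW.
      rewrite -EFinM -EFinD lee_fin le_eqVlt; apply/orP; left; apply/eqP.
      rewrite -/e; field; exact: lt0r_neq0.
    + by apply/measurable_EFinP; apply: measurable_sqmod; exact: cmeasurableB.
    + by move=> t _; rewrite lee_fin sqmod_ge0.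
    + by rewrite lee_fin invr_ge0 mulr_ge0// ltW.
  - by move=> t _; rewrite -EFinM lee_fin mulr_ge0 ?sqmod_ge0 ?invr_ge0 ?mulr_ge0// ltW.
  - apply/measurable_EFinP; apply: measurable_funM => //.
    by apply: measurable_sqmod; exact: cmeasurableB.
  - by move=> t _; rewrite lee_fin divr_ge0// ltW.
have Isum : (\int[m]_t (\sum_(0 <= k <oo) (d k t)%:E) < +oo)%E.
  rewrite integral_nneseries//; last by move=> k; exact/measurable_EFinP.
  apply: le_lt_trans (_ : (\sum_(0 <= k <oo) (2^-1 ^+ k)%:E < +oo)%E).
    by apply: lee_nneseries => // k _ _; exact: integral_ge0.
  have h := @cvg_geometric_eseries_half R 2 0.
  rewrite (_ : limn _ = (2 / 2 ^+ 0)%:E) ?ltry//.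
  apply/cvg_lim => //; apply: cvg_trans h; apply: near_eq_cvg; near=> n.
  apply: eq_bigr => k _; congr EFin.
  by rewrite addn1 expnS natrM invfM mulrA mulfV// mul1r natrX exprVn.
have mS : measurable_fun setT (fun t => \sum_(0 <= k <oo) (d k t)%:E)%E.
  by apply: ge0_emeasurable_sum => // k _; exact/measurable_EFinP.
have S0 t : (0 <= \sum_(0 <= k <oo) (d k t)%:E)%E by exact: nneseries_ge0.
have iS : m.-integrable setT (fun t => \sum_(0 <= k <oo) (d k t)%:E)%E.
  apply/integrableP; split => //.
  by under eq_integral do rewrite gee0_abs//.
apply: filterS (integrable_ae measurableT iS) => t /(_ I).
by rewrite ge0_fin_numE.
Unshelve. all: by end_near. Qed.

Lemma L2_complete (f : nat -> cfun R) : (forall k, L2 (f k)) ->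
  (forall e : R, 0 < e -> exists N, forall i j, (N <= i)%N -> (N <= j)%N ->
     (sqdist (f i) (f j) <= e%:E)%E) ->
  exists2 g, L2 g & forall e : R, 0 < e -> exists N, forall n, (N <= n)%N ->
     (sqdist (f n) g <= e%:E)%E.
Proof.
move=> Lf cf.
have mf k : cmeasurable (f k) by have [] := Lf k.
have /choice[N PN] : forall k, exists N, forall i j, (N <= i)%N -> (N <= j)%N ->
     (sqdist (f i) (f j) <= ((2^-1 ^+ k) ^+ 2)%:E)%E.
  by move=> k; apply: cf; rewrite !exprn_gt0.
(* Cumulative sums make the indices nondecreasing and at least [N k]; the summand [k] makes them
   unbounded. *)
pose n_ k := (\sum_(j < k.+1) N j + k)%N.
have nN k : (N k <= n_ k)%N by rewrite /n_ big_ord_recr/= -addnA addnCA leq_addr.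
have nk k : (k <= n_ k)%N by exact: leq_addl.
have nS k : (n_ k <= n_ k.+1)%N.
  by rewrite /n_ [in leqRHS]big_ord_recr/= leq_add// leq_addr.
pose s k := f (n_ k).
have fast : forall k, (sqdist (s k.+1) (s k) <= ((2^-1 ^+ k) ^+ 2)%:E)%E.
  by move=> k; apply: PN => //; exact: leq_trans (nS k).
have aeS := fast_cauchy_ae_cvg (fun k => mf (n_ k)) fast.
have [hR mhR cR] := measurable_ae_limit (fun k => (mf (n_ k)).1).
have [hI mhI cI] := measurable_ae_limit (fun k => (mf (n_ k)).2).
pose g : cfun R := fun t => hR t +i* hI t.
have mg : cmeasurable g by [].
have aeg : {ae m, forall t, complex.Re (s k t) @[k --> \oo] --> hR t /\
    complex.Im (s k t) @[k --> \oo] --> hI t}.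
  apply: filterS aeS => t St; split.
  - apply: cR; apply: cvgn_dominated_increments St => k.
    rewrite -ReB -sqrtr_sqr ler_wsqrtr// /sqmod /nsq /csub lerDl sqr_ge0.
    by [].
  - apply: cI; apply: cvgn_dominated_increments St => k.
    rewrite -ImB -sqrtr_sqr ler_wsqrtr// /sqmod /nsq /csub lerDr sqr_ge0.
    by [].
have msub n k : measurable_fun setT (fun t => (sqmod (csub (f n) (s k)) t)%:E).
  by apply/measurable_EFinP; apply: measurable_sqmod; exact: (cmeasurableB (mf _) (mf _)).
have mgsub n : measurable_fun setT (fun t => (sqmod (csub (f n) g) t)%:E).
  by apply/measurable_EFinP; apply: measurable_sqmod; exact: (cmeasurableB (mf _) mg).
have X (v : nat -> R) (l : R) : v k @[k --> \oo] --> l -> v k ^+ 2 @[k --> \oo] --> l ^+ 2.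
  by move=> vl; rewrite expr2; under eq_fun do rewrite expr2; exact: cvgM.
have lim n t : complex.Re (s k t) @[k --> \oo] --> hR t -> 
    complex.Im (s k t) @[k --> \oo] --> hI t ->
    sqmod (csub (f n) (s k)) t @[k --> \oo] --> sqmod (csub (f n) g) t.
  move=> c1 c2; rewrite /sqmod /nsq /csub ReB ImB /=.
  under eq_fun do rewrite ReB ImB.
  by apply: cvgD; apply: X; apply: cvgB => //; exact: cvg_cst.
(* Fatou's lemma along the subsequence, with [f n] held fixed. It handles the whole sequence at once
   and also shows that the limit is in [L2]. *)
have key n e K : (forall k, (K <= k)%N -> (sqdist (f n) (s k) <= e%:E)%E) ->
    (sqdist (f n) g <= e%:E)%E.
  move=> H; rewrite /sqdist.
  have F := @fatou _ _ _ m setT measurableT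
    (fun k t => (sqmod (csub (f n) (s k)) t)%:E) (msub n) _.
  rewrite (@ge0_ae_eq_integral _ _ _ m setT _
    (fun t => limn_einf (fun k => (sqmod (csub (f n) (s k)) t)%:E)))//.
  - apply: le_trans (F _) _.
      by move=> k t _; rewrite lee_fin sqmod_ge0.
    rewrite limn_einf_lim; apply: lime_le; first exact: is_cvg_einfs.
    near=> k; apply: (@le_trans _ _ (sqdist (f n) (s k))).
      by apply: ereal_inf_lbound; exists k => /=.
    by apply: H; near: k; exact: nbhs_infty_ge.
  - apply: measurableT_comp => //.
    apply: (measurable_fun_limn_esup (f := fun k t => - (sqmod (csub (f n) (s k)) t)%:E))%E.
    by move=> k; apply: measurableT_comp.
  - by move=> t _; rewrite lee_fin sqmod_ge0.
  - move=> t _; rewrite limn_einf_lim; apply: lime_ge; first exact: is_cvg_einfs.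
    apply: nearW => k; apply: le_ereal_inf_tmp => _ [j _ <-].
    by rewrite lee_fin sqmod_ge0.
  - apply: filterS aeg => t [c1 c2] _.
    have := lim n t c1 c2 => c.
    have /cvg_limn_einf_sup[-> _] // : (sqmod (csub (f n) (s k)) t)%:E @[k --> \oo] --> (sqmod (csub (f n) g) t)%:E.
    by apply: cvg_EFin => //; exact: nearW.
have Lg : L2 g.
  have [N0 h0] := cf 1 ltr01.
  have h : (sqdist (f N0) g <= 1%:E)%E.
    apply: (key _ _ N0) => k kN; apply: h0 => //; exact: leq_trans (nk k).
  have Ld : L2 (csub (f N0) g).
    apply/L2P; split; first exact: cmeasurableB.
    apply/integrableP; split; first exact: mgsub.
    under eq_integral do rewrite gee0_abs ?lee_fin ?sqmod_ge0//.
    by apply: le_lt_trans h _; exact: ltry.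
  have := L2B (Lf N0) Ld; congr L2; apply/funext => t; rewrite /csub.
  by rewrite opprB addrC subrK.
exists g => // e e0; have [N0 h0] := cf e e0; exists N0 => n nN0.
apply: (key _ _ N0) => k kN; apply: h0 => //; exact: leq_trans (nk k).
Unshelve. all: by end_near. Qed.
End riesz_fischer.

(** * Semi-inner product spaces *)

(** Definiteness is absent because it fails for functions that vanish a.e. without being zero. *)
Record semiInner (R : realType) (V : lmodType R[i]) := SemiInner {
  ip :> V -> V -> R[i];
  ipDl : forall f g h, ip (f + g) h = ip f h + ip g h;
  ipZl : forall c f g, ip (c *: f) g = c * ip f g;
  ipC : forall f g, conjc (ip f g) = ip g f;
  ip_ge0 : forall f, 0 <= complex.Re (ip f f) }.

Section semi_inner.
Variables (R : realType) (V : lmodType R[i]) (s : semiInner V).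
Implicit Types (f g h : V) (c : R[i]).

Definition sq f : R := complex.Re (s f f).
Definition nrm f : R := Num.sqrt (sq f).

Lemma ipDr f g h : s f (g + h) = s f g + s f h.
Proof. by rewrite -(ipC s) ipDl rmorphD/= !(ipC s). Qed.

Lemma ipZr c f g : s f (c *: g) = conjc c * s f g.
Proof. by rewrite -(ipC s) ipZl conjcM (ipC s). Qed.

Lemma ipNl f g : s (- f) g = - s f g.
Proof. by rewrite -scaleN1r ipZl mulN1r. Qed.

Lemma ipNr f g : s f (- g) = - s f g.
Proof. by rewrite -(ipC s) ipNl rmorphN/= !(ipC s). Qed.

Lemma ipBl f g h : s (f - g) h = s f h - s g h.
Proof. by rewrite ipDl ipNl. Qed.

Lemma ipBr f g h : s f (g - h) = s f g - s f h.
Proof. by rewrite ipDr ipNr. Qed.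

Lemma ip0l f : s 0 f = 0.
Proof. by rewrite -(scale0r 0) ipZl mul0r. Qed.

Lemma ip_sq f : s f f = (sq f)%:C.
Proof.
have := ipC s f f; rewrite /sq; case: (s f f) => a b /= [] /eqP.
by rewrite -subr_eq0 -opprD oppr_eq0 -mulr2n mulrn_eq0/= => /eqP ->.
Qed.

Lemma sq_ge0 f : 0 <= sq f. Proof. exact: ip_ge0. Qed.

Lemma nrm_ge0 f : 0 <= nrm f. Proof. exact: sqrtr_ge0. Qed.

Lemma nrm_sqr f : nrm f ^+ 2 = sq f.
Proof. by rewrite sqr_sqrtr// sq_ge0. Qed.

Lemma sqD f g : sq (f + g) = sq f + sq g + 2 * complex.Re (s f g).
Proof.
rewrite /sq ipDl !ipDr !ReD -(ipC s g f) ReC; ring.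
Qed.

Lemma sqN f : sq (- f) = sq f.
Proof. by rewrite /sq ipNl ipNr opprK. Qed.

Lemma sqB f g : sq (f - g) = sq f + sq g - 2 * complex.Re (s f g).
Proof. by rewrite sqD sqN ipNr ReN mulrN. Qed.

Lemma sqBC f g : sq (f - g) = sq (g - f).
Proof. by rewrite -sqN opprB. Qed.

Lemma sqZ c f : sq (c *: f) = nsq c * sq f.
Proof.
by rewrite /sq ipZl ipZr mulrA nsqJ ip_sq -rmorphM.
Qed.

Lemma cauchy_schwarz f g : nsq (s f g) <= sq f * sq g.
Proof.
set n := nsq _; have n0 : 0 <= n by exact: nsq_ge0.
have H (r : R) : 0 <= sq f + r ^+ 2 * n * sq g - 2 * (r * n).
  have := sq_ge0 (f - (r%:C * s f g) *: g); rewrite sqB sqZ nsqM nsqR ipZr.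
  suff -> : complex.Re (conjc (r%:C * s f g) * s f g) = r * n by [].
  by rewrite conjcM conjc_real -mulrA [_ * s f g]mulrC nsqJ -rmorphM.
have g0 := sq_ge0 g; have f0 := sq_ge0 f.
have [gE|gN] := eqVneq (sq g) 0.
  rewrite gE mulr0; case: (ltrP 0 n) => // np.
  (* When g is null the quadratic in r degenerates to a linear one, and this r makes it equal to -
     sq f - 2, which is negative. *)
  have := H ((sq f + 1) / n); rewrite gE mulr0 addr0.
  rewrite (_ : _ - _ = - sq f - 2); last by field; exact: lt0r_neq0.
  lra.
have := H (sq g)^-1; rewrite (_ : _ - _ = (sq f * sq g - n) / sq g); last by field.
by rewrite pmulr_lge0 ?subr_ge0// invr_gt0 lt_def gN.
Qed.

Lemma Re_ip_le f g : complex.Re (s f g) <= nrm f * nrm g.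
Proof.
apply: (le_trans (ler_norm _)); rewrite -sqrtr_sqr -sqrtrM ?sq_ge0//.
by rewrite ler_wsqrtr// (le_trans (Re_le_nsq _))// cauchy_schwarz.
Qed.

Lemma sq_null_ip f g : sq f = 0 -> s f g = 0.
Proof.
move=> f0; apply: nsq_eq0; apply/eqP; rewrite eq_le nsq_ge0 andbT.
by rewrite (le_trans (cauchy_schwarz _ _))// f0 mul0r.
Qed.

Lemma sq_null_ipr f g : sq f = 0 -> s g f = 0.
Proof. by move=> f0; rewrite -(ipC s) sq_null_ip// conjc0. Qed.

Lemma sq_congr f g : sq (f - g) = 0 -> sq f = sq g.
Proof.
move=> fg; rewrite -[f in LHS](subrK g) sqD fg add0r sq_null_ip//.
by rewrite mulr0 addr0.
Qed.

(** The exact defect of convexity. As an identity it passes to differences of squared seminorms,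
    which is how it is used for the form [q] in [hankel_step]. *)
Lemma sq_convex (t : R) f g :
  sq ((1 - t)%:C *: f + t%:C *: g) =
  (1 - t) * sq f + t * sq g - t * (1 - t) * sq (f - g).
Proof.
rewrite [LHS]sqD !sqZ sqB !nsqR ipZl ipZr conjc_real mulrA -rmorphM.
have -> : complex.Re (((1 - t) * t)%:C * s f g) = (1 - t) * t * complex.Re (s f g).
  by case: (s f g) => a b; rewrite /= mul0r subr0.
ring.
Qed.

Lemma cvg_sq_shift (f_ : nat -> V) g h :
  sq (f_ n - g) @[n --> \oo] --> (0 : R) -> sq (h - f_ n) @[n --> \oo] --> sq (h - g).
Proof.
move=> fg.
have E n : sq (h - f_ n) = sq (h - g) + sq (f_ n - g) - 2 * complex.Re (s (h - g) (f_ n - g)).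
  by rewrite -sqB opprB addrA subrK.
under eq_fun do rewrite E.
suff : (sq (h - g) + sq (f_ n - g) - 2 * complex.Re (s (h - g) (f_ n - g)))
  @[n --> \oo] --> sq (h - g) + 0 - 2 * 0 by rewrite mulr0 subr0 addr0.
apply: cvgB; first by apply: cvgD => //; exact: cvg_cst.
apply: cvgMl_tmp; apply/cvgr0Pnorm_le => /= e e0.
have K0 : 0 < sq (h - g) + 1 by rewrite ltr_wpDl// sq_ge0.
have d0 : 0 < e ^+ 2 / (sq (h - g) + 1) by rewrite divr_gt0// exprn_gt0.
move/cvgr0Pnorm_le : fg => /(_ _ d0); apply: filterS => n /=.
rewrite ger0_norm ?sq_ge0// => h1.
have e0' := ltW e0; rewrite -(@ler_pXn2r _ 2)// ?nnegrE// real_normK ?num_real//.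
rewrite (le_trans (Re_le_nsq _))// (le_trans (cauchy_schwarz _ _))//.
rewrite (le_trans (ler_wpM2l (sq_ge0 _) h1))//.
rewrite mulrCA ler_piMr ?sqr_ge0// ler_pdivrMr// mul1r lerDl//.
Qed.

End semi_inner.

(** * Minimising sequences of quadratic functions *)

Section minimisation.
Variables (R : realType) (V : lmodType R[i]).

Definition linear_set (H : set V) :=
  H 0 /\ forall (c : R[i]) f g, H f -> H g -> H (c *: f + g).

Lemma linear_setD (H : set V) f g : linear_set H -> H f -> H g -> H (f + g).
Proof. by move=> [_ HL] Hf Hg; rewrite -[f]scale1r; exact: HL. Qed.

Lemma linear_setZ (H : set V) c f : linear_set H -> H f -> H (c *: f).
Proof. by move=> [H0 HL] Hf; rewrite -[_ *: _]addr0; exact: HL. Qed.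

Lemma linear_setB (H : set V) f g : linear_set H -> H f -> H g -> H (f - g).
Proof.
by move=> HL Hf Hg; rewrite -scaleN1r; apply: linear_setD => //; exact: linear_setZ.
Qed.

(* An approximately minimising sequence of a quadratic function [r] with
   homogeneous part [q], together with the Pythagorean-type inequality that
   makes up for the absence of a minimiser. *)
Lemma minimising_sequence (E : set V) (r q : V -> R) :
  E !=set0 -> (forall f, E f -> 0 <= r f) -> (forall f g, E f -> E g -> 0 <= q (f - g)) ->
  (forall (t : R) f g, E f -> E g -> E ((1 - t)%:C *: f + t%:C *: g)) ->
  (forall (t : R) f g, E f -> E g -> r ((1 - t)%:C *: f + t%:C *: g) =
     (1 - t) * r f + t * r g - t * (1 - t) * q (f - g)) ->
  exists (f_ : nat -> V) (I : R), [/\ 0 <= I, forall n, E (f_ n),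
    forall n, r (f_ n) <= I + n.+2%:R^-1,
    forall n k, q (f_ n - f_ k) <= 2 * (n.+2%:R^-1 + k.+2%:R^-1) &
    forall n f, E f -> (1 - n.+2%:R^-1) * q (f_ n - f) <= n.+2%:R^-1 + (r f - I)].
Proof.
move=> E0 r0 q0 Econv rconv; pose I := inf (r @` E).
have hI : has_inf (r @` E).
  split; first by have [f Ef] := E0; exists (r f), f.
  by exists 0 => _ [f Ef <-]; exact: r0.
have I0 : 0 <= I.
  by apply: lb_le_inf => [|_ [f Ef <-]]; [exact: hI.1|exact: r0].
have Ile f : E f -> I <= r f by move=> Ef; apply: ge_inf; [exact: hI.2|exists f].
(* The error is the square of the weight t = 1 / (n + 2) used in the last estimate: after division
   by t an error t remains. The shift by 2 keeps t < 1. *)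
have /choice[f_ Pf] : forall n : nat, exists f, E f /\ r f < I + n.+2%:R^-1 ^+ 2.
  move=> n; have e0 : 0 < n.+2%:R^-1 ^+ 2 :> R by rewrite exprn_gt0// invr_gt0.
  by have [_ [f Ef <-] h] := inf_adherent e0 hI; exists f.
have d1 n : (0 < n.+2%:R^-1 :> R) /\ (n.+2%:R^-1 < 1 :> R).
  by split; [rewrite invr_gt0 ltr0n|rewrite invf_lt1 ?ltr1n ?ltr0n].
have sqle n : n.+2%:R^-1 ^+ 2 <= n.+2%:R^-1 :> R.
  by have [h1 h2] := d1 n; rewrite expr2 ler_piMr// ltW.
(* Minimality tested on a convex combination. The weight 1/2 gives the Cauchy estimate, the weight 1
   / (n + 2) the Pythagorean one. *)
have gen (t : R) f g : E f -> E g ->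
    t * (1 - t) * q (f - g) <= (1 - t) * (r f - I) + t * (r g - I).
  move=> Ef Eg; have := Ile _ (Econv t f g Ef Eg); rewrite rconv//; lra.
exists f_, I; split => //.
- by move=> n; case: (Pf n).
- by move=> n; case: (Pf n) => _ /ltW h; apply: le_trans h _; rewrite lerD2l.
- move=> n k; have [En hn] := Pf n; have [Ek hk] := Pf k.
  have H (a b x y z : R) : x < I + a ^+ 2 -> y < I + b ^+ 2 -> a ^+ 2 <= a -> b ^+ 2 <= b ->
      2^-1 * (1 - 2^-1) * z <= (1 - 2^-1) * (x - I) + 2^-1 * (y - I) -> z <= 2 * (a + b) by lra.
  exact: H hn hk (sqle n) (sqle k) (gen 2^-1 _ _ En Ek).
- move=> n f Ef; have [En hn] := Pf n; have [t0 t1] := d1 n.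
  have := gen n.+2%:R^-1 _ _ En Ef; set t := n.+2%:R^-1 in t0 t1 hn *.
  have rf := Ile _ Ef; have qf := q0 _ _ En Ef.
  have h : (1 - t) * (r (f_ n) - I) <= t ^+ 2.
    apply: (@le_trans _ _ (r (f_ n) - I)); last by lra.
    by rewrite ler_piMl ?subr_ge0 ?Ile//; lra.
  move=> h2; rewrite -(ler_pM2l t0); lra.
Qed.

End minimisation.

Lemma harmonic2 (R : realType) : n.+2%:R^-1 @[n --> \oo] --> (0 : R).
Proof. by have := @cvg_harmonic R; rewrite -(cvg_shiftS (harmonic : nat -> R^o)). Qed.

(** * Completion of a corner entry *)

Section corner.
Variables (R : realType) (V : lmodType R[i]).

(* Scalar Parrott completion: among the values of [B] on the affine space
   [ev = 1], the limit along a minimising sequence of [q] is an admissible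
   corner entry. *)
Lemma corner_completion (H : set V) (q : V -> R) (ev B : V -> R[i]) (F0 : V) :
  linear_set H -> (forall f, H f -> 0 <= q f) ->
  (forall c f, H f -> q (c *: f) = nsq c * q f) ->
  (forall (t : R) f g, H f -> H g -> q ((1 - t)%:C *: f + t%:C *: g) =
     (1 - t) * q f + t * q g - t * (1 - t) * q (f - g)) ->
  (forall c f g, ev (c *: f + g) = c * ev f + ev g) ->
  (forall c f g, B (c *: f + g) = c * B f + B g) ->
  H F0 -> ev F0 = 1 ->
  (forall h, H h -> ev h = 0 -> nsq (B h) <= q h) ->
  exists x, forall f, H f -> nsq (B f - x * ev f) <= q f.
Proof.
move=> HL q0 qZ qconv evL BL HF0 eF0 Bq.
have evD f g : ev (f + g) = ev f + ev g by rewrite -[f in LHS]scale1r evL mul1r.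
have BD f g : B (f + g) = B f + B g by rewrite -[f in LHS]scale1r BL mul1r.
have ev0 : ev 0 = 0 by have /eqP := evD 0 0; rewrite addr0 -subr_eq0 opprD addNKr oppr_eq0 => /eqP.
have B0 : B 0 = 0 by have /eqP := BD 0 0; rewrite addr0 -subr_eq0 opprD addNKr oppr_eq0 => /eqP.
have evZ c f : ev (c *: f) = c * ev f by rewrite -[c *: f]addr0 evL ev0 addr0.
have BZ c f : B (c *: f) = c * B f by rewrite -[c *: f]addr0 BL B0 addr0.
have evB f g : ev (f - g) = ev f - ev g by rewrite evD -scaleN1r evZ mulN1r.
have BB f g : B (f - g) = B f - B g by rewrite BD -scaleN1r BZ mulN1r.
pose E : set V := [set f | H f /\ ev f = 1].
have [||||f_ [I [I0 Ef _ qc qf]]] := @minimising_sequence _ V E q q (ex_intro _ F0 (conj HF0 eF0)).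
- by move=> f [Hf _]; exact: q0.
- by move=> f g [Hf _] [Hg _]; apply: q0; exact: linear_setB.
- move=> t f g [Hf ef] [Hg eg]; split; first by apply: HL.2 => //; exact: linear_setZ.
  by rewrite evD !evZ ef eg !mulr1 -rmorphD subrK.
- by move=> t f g [Hf _] [Hg _]; exact: qconv.
(* Two points of [E] differ by a vector on which [ev] vanishes, where [B] is already controlled.
   Hence [B] is Cauchy along the minimising sequence although [q] has no minimiser. *)
have diff f g : E f -> E g -> nsq (B f - B g) <= q (f - g).
  move=> [Hf ef] [Hg eg]; rewrite -BB; apply: Bq; first exact: linear_setB.
  by rewrite evB ef eg subrr.
have harm := @harmonic2 R.
have C n k : nsq (B (f_ n) - B (f_ k)) <= 2 * (n.+2%:R^-1 + k.+2%:R^-1).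
  exact: le_trans (diff _ _ (Ef n) (Ef k)) (qc n k).
have real_cvg (a : nat -> R) :
    (forall n k, (a n - a k) ^+ 2 <= 2 * (n.+2%:R^-1 + k.+2%:R^-1)) -> cvgn a.
  move=> ha; apply/cauchy_cvgP/cauchy_exP => e e0.
  have d0 : 0 < e ^+ 2 / 4 by rewrite divr_gt0// exprn_gt0.
  have [N _ HN] := cvgr_lt 0 harm _ d0.
  exists (a N); exists N => // k /= Nk; rewrite /ball/=.
  have h1 := HN _ (leqnn N); have h2 := HN _ Nk.
  have H1 (x y z : R) : x < e ^+ 2 / 4 -> y < e ^+ 2 / 4 -> z <= 2 * (x + y) -> z < e ^+ 2 by lra.
  have e0' := ltW e0; rewrite -(@ltr_pXn2r _ 2)// ?nnegrE// real_normK ?num_real//.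
  exact: H1 h1 h2 (ha N k).
have /cvg_ex[x1 c1] : cvgn (fun n => complex.Re (B (f_ n))).
  apply: real_cvg => n k; apply: le_trans (C n k); apply: le_trans (Re_le_nsq _).
  by rewrite !(ReD, ReN).
have /cvg_ex[x2 c2] : cvgn (fun n => complex.Im (B (f_ n))).
  apply: real_cvg => n k; apply: le_trans (C n k); apply: le_trans (Im_le_nsq _).
  by case: (B (f_ n)) => a b; case: (B (f_ k)).
pose x : R[i] := x1 +i* x2; exists x.
have main f : E f -> nsq (B f - x) <= q f.
  move=> Hf.
  have X (v : nat -> R) (l : R) : v k @[k --> \oo] --> l -> v k ^+ 2 @[k --> \oo] --> l ^+ 2.
    by move=> vl; rewrite expr2; under eq_fun do rewrite expr2; exact: cvgM.
  have L1 : (1 - n.+2%:R^-1) * nsq (B (f_ n) - B f) @[n --> \oo] --> nsq (B f - x).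
    rewrite -nsqN opprB -[X in _ --> X]mul1r; apply: cvgM.
      by rewrite -[X in _ --> X]subr0; apply: cvgB => //; exact: cvg_cst.
    rewrite /nsq; apply: cvgD; apply: X.
      rewrite !(ReD, ReN) /=; under eq_fun do rewrite ReD ReN.
      by apply: cvgB => //; exact: cvg_cst.
    rewrite ImB /=; under eq_fun do rewrite ImB.
    by apply: cvgB => //; exact: cvg_cst.
  have L2 : n.+2%:R^-1 + (q f - I) @[n --> \oo] --> q f - I.
    by rewrite -[X in _ --> X]add0r; apply: cvgD => //; exact: cvg_cst.
  have : nsq (B f - x) <= q f - I.
    apply: (ler_cvg_to L1 L2); near=> n.
    apply: le_trans (qf n f Hf); rewrite ler_wpM2l ?diff//.
    by rewrite subr_ge0 invf_le1 ?ler1n ?ltr0n.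
  by move/le_trans; apply; rewrite lerBlDr lerDl.
(* By homogeneity the estimate on [ev f = 1] covers every f with [ev f] nonzero; the remaining case
   is the hypothesis on [B]. *)
move=> f Hf; have [e0|eN] := eqVneq (ev f) 0.
  by rewrite e0 mulr0 subr0; exact: Bq.
have : E ((ev f)^-1 *: f) by split; [exact: linear_setZ|rewrite evZ mulVf].
move/main; rewrite qZ// BZ => h.
have -> : B f - x * ev f = ev f * ((ev f)^-1 * B f - x) by rewrite mulrBr mulVKf// mulrC.
rewrite nsqM; apply: le_trans (ler_wpM2l (nsq_ge0 _) h) _.
by rewrite mulrA -nsqM mulfV// /nsq/= expr1n expr0n addr0 mul1r.
Unshelve. all: by end_near. Qed.

End corner.

(** * Orthogonal projection onto closed subspaces *)

Section projection.
Variables (R : realType) (V : lmodType R[i]) (s : semiInner V).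
Local Notation sq := (sq s).

Definition complete_inner := forall f_ : nat -> V,
  (forall e : R, 0 < e -> exists N, forall i j, (N <= i)%N -> (N <= j)%N ->
     sq (f_ i - f_ j) <= e) ->
  exists g, sq (f_ n - g) @[n --> \oo] --> (0 : R).

Definition closed_inner (E : set V) := forall (f_ : nat -> V) g,
  (forall n, E (f_ n)) -> sq (f_ n - g) @[n --> \oo] --> (0 : R) -> E g.

Lemma projection_exists (E : set V) f : complete_inner -> linear_set E ->
  closed_inner E -> exists g, E g /\ forall h, E h -> s (f - g) h = 0.
Proof.
move=> cV EL cE.
have conv (t : R) g h : E g -> E h -> E ((1 - t)%:C *: g + t%:C *: h).
  by move=> Eg Eh; apply: EL.2 => //; exact: linear_setZ.
have [||||f_ [I [I0 Ef rI qc qf]]] := @minimising_sequence _ V E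
    (fun h => sq (f - h)) sq (ex_intro _ 0 EL.1).
- by move=> h _; exact: sq_ge0.
- by move=> g h _ _; exact: sq_ge0.
- exact: conv.
- move=> t g h _ _; rewrite (sqBC _ g h).
  rewrite (_ : f - _ = (1 - t)%:C *: (f - g) + t%:C *: (f - h)).
    have e : f - g - (f - h) = h - g by rewrite opprB addrC addrA subrK.
    by rewrite sq_convex e.
  rewrite !scalerBr addrACA -scalerDl -rmorphD subrK scale1r opprD.
  by [].
have [g fg] : exists g, sq (f_ n - g) @[n --> \oo] --> (0 : R).
  apply: cV => e e0; have d0 : 0 < e / 4 by rewrite divr_gt0.
  have [N _ HN] := cvgr_lt 0 (@harmonic2 R) _ d0.
  exists N => i j Ni Nj; have h1 := HN _ Ni; have h2 := HN _ Nj.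
  have H1 (x y z : R) : x < e / 4 -> y < e / 4 -> z <= 2 * (x + y) -> z <= e by lra.
  exact: H1 h1 h2 (qc i j).
have Eg : E g by exact: cE fg.
have d_le : sq (f - g) <= I.
  have L2 : I + n.+2%:R^-1 @[n --> \oo] --> I.
    by rewrite -[X in _ --> X]addr0; apply: cvgD; [exact: cvg_cst|exact: harmonic2].
  by apply: (ler_cvg_to (cvg_sq_shift (h := f) fg) L2); near=> n; exact: rI.
(* In the limit the Pythagorean estimate says more than minimality of g: moving by h costs at least
   [sq h]. Expanding the square therefore gives a sign for the real part directly, with no small
   parameter. *)
have best h : E h -> sq h + sq (f - g) <= sq (f - g - h).
  move=> Eh; have Egh : E (g + h) by exact: linear_setD.
  have L1 : (1 - n.+2%:R^-1) * sq (g + h - f_ n) @[n --> \oo] --> sq (g + h - g).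
    rewrite -[X in _ --> X]mul1r; apply: cvgM; last exact: cvg_sq_shift.
    by rewrite -[X in _ --> X]subr0; apply: cvgB; [exact: cvg_cst|exact: harmonic2].
  have L2 : n.+2%:R^-1 + (sq (f - (g + h)) - I) @[n --> \oo] --> sq (f - (g + h)) - I.
    by rewrite -[X in _ --> X]add0r; apply: cvgD; [exact: harmonic2|exact: cvg_cst].
  have : sq (g + h - g) <= sq (f - (g + h)) - I.
    apply: (ler_cvg_to L1 L2); near=> n.
    by rewrite sqBC; exact: qf.
  have -> : g + h - g = h by rewrite addrC addKr.
  by rewrite opprD addrA lerBrDr; apply: le_trans; rewrite lerD2l.
have Rle h : E h -> complex.Re (s (f - g) h) <= 0.
  by move=> /best; rewrite [leRHS]sqB; lra.
have Re0 h : E h -> complex.Re (s (f - g) h) = 0.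
  move=> Eh; apply/eqP; rewrite eq_le Rle//=.
  have := Rle (- h); rewrite ipNr ReN oppr_le0; apply.
  by rewrite -scaleN1r; exact: linear_setZ.
exists g; split => // h Eh; have := Re0 _ Eh.
(* The real part against i h is the imaginary part against h. *)
have := Re0 ('i%C *: h) (linear_setZ _ EL Eh); rewrite ipZr.
by case: (s (f - g) h) => a b /=; rewrite mul0r mulN1r opprK add0r => -> ->.
Unshelve. all: by end_near. Qed.

End projection.

(** * L2 as a semi-inner product space *)

(** The codomain [R[i]^o] is the field as a module over itself; the vector space structure of L^2 is
    then inherited from the module of all functions. *)
Definition L2pred (R : realType) : {pred measurableTypeR R -> R[i]^o} :=
  fun f => `[< L2 (f : cfun R) >].

Lemma L2_submod_closed (R : realType) : submod_closed (@L2pred R).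
Proof.
split; first by apply/asboolP; exact: (L2_cst 0).
move=> c f g /asboolP Lf /asboolP Lg; apply/asboolP.
exact: L2D (L2Z c Lf) Lg.
Qed.

HB.instance Definition _ (R : realType) :=
  GRing.isSubmodClosed.Build _ _ (@L2pred R) (@L2_submod_closed R).

Record L2fun (R : realType) := MkL2 {
  L2val : measurableTypeR R -> R[i]^o;
  L2valP : L2val \in @L2pred R }.

HB.instance Definition _ (R : realType) := [isSub for @L2val R].
HB.instance Definition _ (R : realType) := [Choice of L2fun R by <:].
HB.instance Definition _ (R : realType) := [SubChoice_isSubLmodule of L2fun R by <:].


Section L2_space.
Variable R : realType.
Notation m := (circle_measure R).
Notation V := (L2fun R).
Implicit Types (f g : V) (a b : cfun R).

(** Total, with value 0 off [L2], so that multiplication operators can be written without carrying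
    membership proofs. *)
Definition toL2 a : V := insubd 0 (a : measurableTypeR R -> R[i]^o).

Lemma L2valD f g t : L2val (f + g) t = L2val f t + L2val g t.
Proof. by []. Qed.

Lemma L2valZ c f t : L2val (c *: f) t = c * L2val f t.
Proof. by []. Qed.

Lemma L2valB f g t : L2val (f - g) t = L2val f t - L2val g t.
Proof. by []. Qed.

Lemma toL2K a : L2 a -> L2val (toL2 a) = a.
Proof.
move=> La; rewrite /toL2 -[LHS]/(\val _) val_insubd; case: ifPn => // /negP[].
exact/asboolP.
Qed.

Lemma L2val_L2 f : L2 (L2val f : cfun R).
Proof. by case: f => f /= /asboolP. Qed.

Lemma L2val_inj f g : (forall t, L2val f t = L2val g t) -> f = g.
Proof. by move=> fg; apply: val_inj; exact/funext. Qed.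

Lemma toL2val f : toL2 (L2val f) = f.
Proof. by apply: val_inj; exact: (toL2K (L2val_L2 f)). Qed.

Lemma L2_conj a : L2 a -> L2 (cconj a).
Proof.
move=> /L2P[ma ia]; apply/L2P; split; first exact: cmeasurable_conj.
rewrite (_ : sqmod (cconj a) = sqmod a)//; apply/funext => t.
by rewrite /sqmod /nsq /cconj; case: (a t) => x y /=; rewrite sqrrN.
Qed.

Definition l2_ip f g : R[i] := inner_prod (L2val f) (L2val g).

Let cint f g : cintegrable (cmul (L2val f) (cconj (L2val g))).
Proof. by apply: cintegrable_mul; [|apply: L2_conj]; exact: L2val_L2. Qed.

Lemma l2_ipDl f g h : l2_ip (f + g) h = l2_ip f h + l2_ip g h.
Proof.
rewrite /l2_ip /inner_prod -cintegralD//; congr cintegral; apply/funext => t.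
by rewrite /cmul -mulrDl.
Qed.

Lemma l2_ipZl c f g : l2_ip (c *: f) g = c * l2_ip f g.
Proof.
rewrite /l2_ip /inner_prod -cintegralZ//; congr cintegral; apply/funext => t.
by rewrite /cmul mulrA.
Qed.

Lemma l2_ipC f g : conjc (l2_ip f g) = l2_ip g f.
Proof.
rewrite /l2_ip /inner_prod -cintegral_conj//; congr cintegral; apply/funext => t.
by rewrite /cmul /cconj conjcM conjcK mulrC.
Qed.

Lemma l2_ip_sq f : complex.Re (l2_ip f f) = \int[m]_t sqmod (L2val f) t.
Proof.
apply: eq_Rintegral => t _; rewrite /cmul /cconj /sqmod /nsq.
by case: (L2val f t) => x y /=; ring.
Qed.

Lemma l2_ip_ge0 f : 0 <= complex.Re (l2_ip f f).
Proof. by rewrite l2_ip_sq; apply: Rintegral_ge0 => t _; exact: sqmod_ge0. Qed.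

Definition l2 : semiInner V := SemiInner l2_ipDl l2_ipZl l2_ipC l2_ip_ge0.

Lemma sq_int f : sq l2 f = \int[m]_t sqmod (L2val f) t.
Proof. exact: l2_ip_sq. Qed.

Lemma norm2_nrm f : norm2 (L2val f) = nrm l2 f.
Proof.
rewrite /nrm sq_int -norm2E; last exact: L2val_L2.
by rewrite sqrtr_sqr ger0_norm// norm2_ge0.
Qed.

Lemma sq_ae0 f : sq l2 f = 0 <-> {ae m, forall t, L2val f t = 0}.
Proof.
have [mf fi] := (L2P _).1 (L2val_L2 f).
have msf : measurable_fun setT (EFin \o sqmod (L2val f)).
  by apply/measurable_EFinP; exact: measurable_sqmod.
have E : (sq l2 f)%:E = (\int[m]_t `|(sqmod (L2val f) t)%:E|)%E.
  rewrite sq_int /Rintegral fineK; last exact: integrable_fin_num.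
  by apply: eq_integral => t _; rewrite gee0_abs// lee_fin sqmod_ge0.
split=> [f0|f0].
  move: E; rewrite f0 => /esym/(ae_eq_integral_abs m measurableT msf).1.
  apply: filterS => t /(_ I)/= [] h; apply: nsq_eq0; exact: h.
apply: EFin_inj; rewrite E; apply/(ae_eq_integral_abs m measurableT msf).2.
apply: filterS f0 => t f0 _ /=; rewrite /sqmod /nsq f0 /=.
by rewrite expr0n addr0.
Qed.

Lemma sq_eq_ae f g : sq l2 (f - g) = 0 <-> {ae m, forall t, L2val f t = L2val g t}.
Proof.
rewrite sq_ae0; split; apply: filterS => t.
  by move=> /eqP; rewrite [L2val (f - g) t]/(L2val f t - L2val g t) subr_eq0 => /eqP.
by move=> e; rewrite -[LHS]/(L2val f t - L2val g t) e subrr.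
Qed.

Lemma l2_complete : complete_inner l2.
Proof.
move=> f_ cf.
have D i (g : cfun R) : L2 g -> sqdist (L2val (f_ i)) g = (sq l2 (f_ i - toL2 g))%:E.
  move=> Lg; rewrite sq_int /Rintegral fineK; last first.
    apply: integrable_fin_num => //.
    by have [] := (L2P _).1 (L2val_L2 (f_ i - toL2 g)).
  apply: eq_integral => t _; congr EFin.
  by rewrite -[L2val (_ - _)]/(L2val (f_ i) - L2val (toL2 g)) toL2K.
have [||g Lg cg] := @L2_complete R (fun i => L2val (f_ i)).
- by move=> k; exact: L2val_L2.
- move=> e e0; have [N HN] := cf e e0; exists N => i j Ni Nj.
  by rewrite D ?toL2val ?lee_fin ?HN//; exact: L2val_L2.
exists (toL2 g); apply/cvgr0Pnorm_le => /= e e0; have [N HN] := cg e e0.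
near=> n; rewrite ger0_norm ?sq_ge0// -lee_fin -D//; apply: HN.
by near: n; exact: nbhs_infty_ge.
Unshelve. all: by end_near. Qed.

(** This is L^infinity, with the bound placed on the squared modulus; [LinftyP] is the
    dictionary. *)
Definition multiplier a := cmeasurable a /\ bounded_cfun a.

Definition mulby a f : V := toL2 (cmul a (L2val f)).

Lemma sqmodM a b t : sqmod (cmul a b) t = sqmod a t * sqmod b t.
Proof. by rewrite /sqmod /nsq /cmul; case: (a t) => ? ?; case: (b t) => ? ? /=; ring. Qed.

Lemma sqmod_conj a t : sqmod (cconj a) t = sqmod a t.
Proof. by rewrite /sqmod /nsq /cconj; case: (a t) => ? ? /=; rewrite sqrrN. Qed.

Lemma multiplier_cst c : multiplier (fun=> c).
Proof.
split; first exact: cmeasurable_cst.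
by exists (nsq c); apply: aeW => t.
Qed.

Lemma multiplierM a b : multiplier a -> multiplier b -> multiplier (cmul a b).
Proof.
move=> [ma [M aM]] [mb [N bN]]; split; first exact: cmeasurableM.
exists (M * N); apply: filterS2 aM bN => t h1 h2.
by rewrite sqmodM ler_pM// sqmod_ge0.
Qed.

Lemma multiplierD a b : multiplier a -> multiplier b -> multiplier (fun t => a t + b t).
Proof.
move=> [ma [M aM]] [mb [N bN]]; split; first exact: cmeasurableD.
exists (2 * (M + N)); apply: filterS2 aM bN => t h1 h2.
apply: le_trans (_ : 2 * (sqmod a t + sqmod b t) <= _); last first.
  by rewrite ler_wpM2l// lerD.
rewrite /sqmod /nsq; case: (a t) => x y; case: (b t) => z w /=; rewrite -subr_ge0.
rewrite (_ : _ - _ = (x - z) ^+ 2 + (y - w) ^+ 2); last by ring.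
by rewrite addr_ge0// sqr_ge0.
Qed.

Lemma multiplierB a b : multiplier a -> multiplier b -> multiplier (csub a b).
Proof.
move=> ma mb; have := multiplierD ma (multiplierM (multiplier_cst (-1)) mb).
by congr multiplier; apply/funext => t; rewrite /csub /cmul mulN1r.
Qed.

Lemma multiplier_conj a : multiplier a -> multiplier (cconj a).
Proof.
move=> [ma [M aM]]; split; first exact: cmeasurable_conj.
by exists M; apply: filterS aM => t; rewrite sqmod_conj.
Qed.

Lemma multiplier_L2 a : multiplier a -> L2 a.
Proof.
move=> [ma Ma]; have := L2M ma Ma (L2_cst 1).
by congr L2; apply/funext => t; rewrite /cmul mulr1.
Qed.

Lemma mulbyE a f : multiplier a -> L2val (mulby a f) = cmul a (L2val f).
Proof. by move=> [ma Ma]; rewrite toL2K//; apply: L2M => //; exact: L2val_L2. Qed.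

Lemma mulbyD a f g : multiplier a -> mulby a (f + g) = mulby a f + mulby a g.
Proof.
move=> ma; apply: L2val_inj => t; rewrite mulbyE// L2valD !mulbyE// /cmul.
by rewrite -mulrDr.
Qed.

Lemma mulbyZ a c f : multiplier a -> mulby a (c *: f) = c *: mulby a f.
Proof.
move=> ma; apply: L2val_inj => t; rewrite mulbyE// L2valZ mulbyE// /cmul.
by rewrite mulrCA.
Qed.

Lemma mulbyN a f : multiplier a -> mulby a (- f) = - mulby a f.
Proof. by move=> ma; rewrite -scaleN1r mulbyZ// scaleN1r. Qed.

Lemma mulbyB a f g : multiplier a -> mulby a (f - g) = mulby a f - mulby a g.
Proof. by move=> ma; rewrite mulbyD// mulbyN. Qed.

Lemma mulbyA a b f : multiplier a -> multiplier b -> mulby a (mulby b f) = mulby (cmul a b) f.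
Proof.
move=> ma mb; apply: L2val_inj => t; rewrite !mulbyE//; last exact: multiplierM.
by rewrite /cmul mulrA.
Qed.

Lemma mulbyC a b f : multiplier a -> multiplier b -> mulby a (mulby b f) = mulby b (mulby a f).
Proof.
move=> ma mb; rewrite !mulbyA//; congr mulby; apply/funext => t.
by rewrite /cmul mulrC.
Qed.

Lemma mulby_sub a b f : multiplier a -> multiplier b -> mulby (csub a b) f = mulby a f - mulby b f.
Proof.
move=> ma mb; apply: L2val_inj => t; rewrite mulbyE; last exact: multiplierB.
rewrite L2valB !mulbyE//.
by rewrite /cmul /csub -mulrBl.
Qed.

Lemma mulby_add a b f : multiplier a -> multiplier b ->
  mulby (fun t => a t + b t) f = mulby a f + mulby b f.
Proof.
move=> ma mb; apply: L2val_inj => t; rewrite mulbyE; last exact: multiplierD.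
by rewrite L2valD !mulbyE// /cmul -mulrDl.
Qed.

Lemma mulby_cst c f : mulby (fun=> c) f = c *: f.
Proof.
by apply: L2val_inj => t; rewrite mulbyE//; exact: multiplier_cst.
Qed.

Lemma mulby_adj a f g : multiplier a -> l2 (mulby a f) g = l2 f (mulby (cconj a) g).
Proof.
move=> ma; rewrite -[LHS]/(inner_prod _ _) -[RHS]/(inner_prod _ _) !mulbyE//.
  rewrite /inner_prod; congr cintegral; apply/funext => t.
  by rewrite /cmul /cconj conjcM conjcK -mulrA mulrCA mulrA.
exact: multiplier_conj.
Qed.

Lemma le_sq_ae f g : {ae m, forall t, sqmod (L2val f) t <= sqmod (L2val g) t} ->
  sq l2 f <= sq l2 g.
Proof.
move=> fg; have [mf fi] := (L2P _).1 (L2val_L2 f); have [mg gi] := (L2P _).1 (L2val_L2 g).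
rewrite !sq_int; apply: fine_le; [exact: integrable_fin_num..|].
apply: ae_ge0_le_integral => //=.
- by move=> t _; rewrite lee_fin sqmod_ge0.
- by apply/measurable_EFinP; exact: measurable_sqmod.
- by move=> t _; rewrite lee_fin sqmod_ge0.
- by apply/measurable_EFinP; exact: measurable_sqmod.
- by apply: filterS fg => t fg _; rewrite lee_fin.
Qed.

Lemma sq_mul_le a f (M : R) : multiplier a -> {ae m, forall t, sqmod a t <= M ^+ 2} ->
  sq l2 (mulby a f) <= M ^+ 2 * sq l2 f.
Proof.
move=> ma aM; rewrite -nsqR -sqZ; apply: le_sq_ae; apply: filterS aM => t aM.
rewrite mulbyE// -[sqmod (L2val (_ *: _)) t]/(nsq (M%:C * L2val f t)) nsqM nsqR.
by rewrite sqmodM ler_wpM2r// sqmod_ge0.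
Qed.

Lemma sq_mul_ge a f (M : R) : multiplier a -> {ae m, forall t, M ^+ 2 <= sqmod a t} ->
  M ^+ 2 * sq l2 f <= sq l2 (mulby a f).
Proof.
move=> ma aM; rewrite -nsqR -sqZ; apply: le_sq_ae; apply: filterS aM => t aM.
rewrite mulbyE// -[sqmod (L2val (_ *: _)) t]/(nsq (M%:C * L2val f t)) nsqM nsqR.
by rewrite sqmodM ler_wpM2r// sqmod_ge0.
Qed.

End L2_space.

(** * Fourier coefficients *)

Section monomials.
Variable R : realType.
Notation mu := (@lebesgue_measure R).
Notation D := (`[0, 2 * pi]%classic : set (measurableTypeR R)).
Notation m := (circle_measure R).
Notation V := (L2fun R).
Notation e := (@monomial R).
Implicit Types (f g : V) (a b : cfun R) (n : int).

Lemma Rintegral_derive (F f : R -> R) : (forall x : R, is_derive x 1 F (f x)) ->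
  continuous f -> \int[mu]_(t in D) f t = F (2 * pi) - F 0.
Proof.
move=> dF cf; rewrite /Rintegral (@continuous_FTC2 _ f F)//.
- exact: twopi_gt0.
- by apply: continuous_in_subspaceT => x _; exact: cf.
- have cF x : {for x, continuous F}.
    by apply: differentiable_continuous; apply/derivable1_diffP; have [] := dF x.
  split.
  + by move=> x _; have [] := dF x.
  + by apply: cvg_at_right_filter; exact: cF.
  + by apply: cvg_at_left_filter; exact: cF.
- by move=> x _; rewrite derive1E; apply: derive_val.
Qed.

Lemma is_derive_sinZ (c x : R) : is_derive x 1 (fun y => sin (c * y)) (c * cos (c * x)).
Proof.
have dc : is_derive x 1 (c \*: (@id R)) (c *: (1 : R)) by exact: is_deriveZ.
have := is_derive1_comp (is_derive_sin (c *: x)) dc.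
by rewrite /comp /= /GRing.scale/= mulr1 mulrC.
Qed.

Lemma is_derive_cosZ (c x : R) : is_derive x 1 (fun y => cos (c * y)) (- (c * sin (c * x))).
Proof.
have dc : is_derive x 1 (c \*: (@id R)) (c *: (1 : R)) by exact: is_deriveZ.
have := is_derive1_comp (is_derive_cos (c *: x)) dc.
by rewrite /comp /= /GRing.scale/= mulr1 mulrC mulrN.
Qed.

Lemma cos_sin_period n : cos (n%:~R * (2 * pi)) = 1 :> R /\ sin (n%:~R * (2 * pi)) = 0 :> R.
Proof.
have nat_case (k : nat) : cos (k%:R * (2 * pi)) = 1 :> R /\ sin (k%:R * (2 * pi)) = 0 :> R.
  have -> : k%:R * (2 * pi) = 0 + (pi *+ 2) *+ k :> R.
    by rewrite add0r -[RHS]mulr_natl mulr2n mulrDl mul1r.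
  rewrite (periodicn (@cosD2pi R)) (periodicn (@sinD2pi R)).
  by rewrite cos0 sin0.
case: n => k; first exact: nat_case.
rewrite NegzE mulrNz mulNr cosN sinN.
by have [-> ->] := nat_case k.+1; rewrite oppr0.
Qed.

Lemma monomialD n k t : e n t * e k t = e (n + k) t.
Proof.
rewrite /monomial intrD mulrDl cosD sinD; apply/eqP; rewrite eq_complex/=.
by apply/andP; split; apply/eqP; ring.
Qed.

Lemma monomial0 : e 0 = fun=> 1.
Proof. by apply/funext => t; rewrite /monomial mul0r cos0 sin0. Qed.

Lemma cmul_monomial n k : cmul (e n) (e k) = e (n + k).
Proof. by apply/funext => t; exact: monomialD. Qed.

Lemma cconj_monomial n : cconj (e n) = e (- n).
Proof. by apply/funext => t; rewrite /cconj /monomial mulrNz mulNr cosN sinN. Qed.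

Lemma sqmod_monomial n t : sqmod (e n) t = 1.
Proof. by rewrite /sqmod /nsq/= cos2Dsin2. Qed.

Lemma multiplier_monomial n : multiplier (e n).
Proof.
split; last by exists 1; apply: aeW => t; rewrite sqmod_monomial.
by split => /=; apply: measurableT_comp => //;
  apply: continuous_measurable_fun; [exact: continuous_cos|exact: continuous_sin].
Qed.

Lemma cintegral_monomial n : n != 0 -> cintegral (e n) = 0.
Proof.
move=> n0; have c0 : n%:~R != 0 :> R by rewrite intr_eq0.
have cont_lin : continuous (fun y : R => n%:~R * y) by move=> y; exact: mulrl_continuous.
have [pc ps] := cos_sin_period n.
have Ec (f : R -> R) : continuous f -> (forall t, `|f t| <= 1) ->
    m.-integrable setT (EFin \o (f : measurableTypeR R -> R)).
  move=> cf f1; apply: measurable_bounded_integrable => //.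
  - by apply: le_lt_trans (ltry 1); exact: probability_le1.
  - exact: continuous_measurable_fun.
  - by exists 1; split => // M /ltW M1 t _; exact: le_trans (f1 t) M1.
have cc : continuous (fun t : R => cos (n%:~R * t)).
  by move=> t; apply: continuous_comp; [exact: cont_lin|exact: continuous_cos].
have cs : continuous (fun t : R => sin (n%:~R * t)).
  by move=> t; apply: continuous_comp; [exact: cont_lin|exact: continuous_sin].
rewrite /cintegral /=; apply/eqP; rewrite eq_complex/=; apply/andP; split; apply/eqP.
- rewrite Rintegral_circle; last by apply: Ec => // t; rewrite ler_norml cos_geN1 cos_le1.
  have dF (x : R) : is_derive x 1 (fun y => n%:~R^-1 * sin (n%:~R * y)) (cos (n%:~R * x)).
    have := is_deriveZ n%:~R^-1 (is_derive_sinZ n%:~R x).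
    by rewrite /GRing.scale/= mulKf.
  by rewrite (Rintegral_derive dF cc) ps !mulr0 sin0 mulr0 subr0 mulr0.
- rewrite Rintegral_circle; last by apply: Ec => // t; rewrite ler_norml sin_geN1 sin_le1.
  have dF (x : R) : is_derive x 1 (fun y => - n%:~R^-1 * cos (n%:~R * y)) (sin (n%:~R * x)).
    have := is_deriveZ (- n%:~R^-1) (is_derive_cosZ n%:~R x).
    by rewrite /GRing.scale/= mulrNN mulKf.
  by rewrite (Rintegral_derive dF cs) pc mulr0 cos0 subrr mulr0.
Qed.

Definition fourier_basis n : V := toL2 (e n).
Notation E := fourier_basis.

Lemma mulby_E n k : mulby (e n) (E k) = E (n + k).
Proof.
have L k' : L2 (e k') by apply: multiplier_L2; exact: multiplier_monomial.
apply: L2val_inj => t; rewrite mulbyE ?toL2K//; last exact: multiplier_monomial.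
by rewrite /cmul monomialD.
Qed.

Lemma mulby_mon n k f : mulby (e n) (mulby (e k) f) = mulby (e (n + k)) f.
Proof. by rewrite mulbyA ?cmul_monomial//; exact: multiplier_monomial. Qed.

Lemma mulby_mon0 f : mulby (e 0) f = f.
Proof. by rewrite monomial0 mulby_cst scale1r. Qed.

Lemma ip_mon n f g : l2 R (mulby (e n) f) g = l2 R f (mulby (e (- n)) g).
Proof. by rewrite mulby_adj ?cconj_monomial//; exact: multiplier_monomial. Qed.

Lemma ip_E n k : l2 R (E n) (E k) = (n == k)%:R.
Proof.
rewrite -[LHS]/(inner_prod _ _) /inner_prod !toL2K; try (apply: multiplier_L2; exact: multiplier_monomial).
rewrite cconj_monomial cmul_monomial; case: eqVneq => [->|nk].
  rewrite subrr monomial0 /cintegral /= !Rintegral_cst//.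
  rewrite mul0r mul1r [X in fine X](_ : _ = 1%E) //; exact: probability_setT.
by rewrite cintegral_monomial// subr_eq0.
Qed.

Lemma sq_E n : sq (l2 R) (E n) = 1.
Proof. by rewrite /sq ip_E eqxx. Qed.

Lemma sq_mul_unimodular a f : multiplier a -> {ae m, forall t, sqmod a t = 1} ->
  sq (l2 R) (mulby a f) = sq (l2 R) f.
Proof.
move=> ma a1.
have -> : sq (l2 R) (mulby a f) = complex.Re (l2 R f (mulby (fun=> 1) f)).
  rewrite /sq mulby_adj// mulbyA//; last exact: multiplier_conj.
  congr (complex.Re _); apply/eqP; rewrite -subr_eq0 -ipBr; apply/eqP.
  apply: sq_null_ipr; apply/sq_eq_ae.
  apply: filterS a1 => t a1; rewrite !mulbyE; [|exact: multiplier_cst|].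
    by rewrite /cmul /cconj [_ * a t]mulrC nsqJ [nsq _]a1.
  by apply: multiplierM => //; exact: multiplier_conj.
by rewrite mulby_cst scale1r.
Qed.

Lemma sq_mon n f : sq (l2 R) (mulby (e n) f) = sq (l2 R) f.
Proof.
apply: sq_mul_unimodular; first exact: multiplier_monomial.
by apply: aeW => t; rewrite sqmod_monomial.
Qed.

End monomials.

(** * Trigonometric polynomials and completeness of the Fourier system *)

Section trigonometric.
Variable R : realType.
Notation m := (circle_measure R).
Notation V := (L2fun R).
Notation e := (@monomial R).
Notation E := (@fourier_basis R).
Implicit Types (f g : V) (a b p : cfun R) (n : int).

Definition fcoef f n : R[i] := l2 R f (E n).

Lemma fcoefD f g n : fcoef (f + g) n = fcoef f n + fcoef g n.
Proof. exact: ipDl. Qed.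

Lemma fcoefB f g n : fcoef (f - g) n = fcoef f n - fcoef g n.
Proof. exact: ipBl. Qed.

Lemma fcoefZ c f n : fcoef (c *: f) n = c * fcoef f n.
Proof. exact: ipZl. Qed.

Lemma fcoef_mon k f n : fcoef (mulby (e k) f) n = fcoef f (n - k).
Proof. by rewrite /fcoef ip_mon mulby_E addrC. Qed.

Lemma fcoef_E k n : fcoef (E k) n = (k == n)%:R.
Proof. exact: ip_E. Qed.

(* [p] shifts the bounds of the Fourier support of any function by a bounded
   amount; for bounded [p] this means that [p] is a trigonometric polynomial. *)
Definition trig p := multiplier p /\ exists K : nat, forall f (c : int),
  ((forall n, n < c -> fcoef f n = 0) -> forall n, n < c - K%:Z -> fcoef (mulby p f) n = 0) /\
  ((forall n, c < n -> fcoef f n = 0) -> forall n, c + K%:Z < n -> fcoef (mulby p f) n = 0).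

Lemma trig_cst (c : R[i]) : trig (fun=> c).
Proof.
split; first exact: multiplier_cst.
exists 0%N => f d; split=> h n hn; rewrite mulby_cst fcoefZ h ?mulr0//; lia.
Qed.

Lemma trig_monomial k : trig (e k).
Proof.
split; first exact: multiplier_monomial.
exists `|k|%N => f c; split=> h n hn; rewrite fcoef_mon h//; lia.
Qed.

Lemma trigM p q : trig p -> trig q -> trig (cmul p q).
Proof.
move=> [mp [K pK]] [mq [L qL]]; split; first exact: multiplierM.
exists (K + L)%N => f c; split=> h n hn; rewrite -mulbyA//.
  apply: ((pK _ (c - L%:Z)).1 ((qL f c).1 h)); lia.
apply: ((pK _ (c + L%:Z)).2 ((qL f c).2 h)); lia.
Qed.

Lemma trigD p q : trig p -> trig q -> trig (fun t => p t + q t).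
Proof.
move=> [mp [K pK]] [mq [L qL]]; split; first exact: multiplierD.
exists (K + L)%N => f c; split=> h n hn; rewrite mulby_add// fcoefD.
  by rewrite ((pK f c).1 h) ?((qL f c).1 h) ?addr0//; lia.
by rewrite ((pK f c).2 h) ?((qL f c).2 h) ?addr0//; lia.
Qed.

Lemma trigB p q : trig p -> trig q -> trig (csub p q).
Proof.
move=> tp tq; have := trigD tp (trigM (trig_cst (-1)) tq).
by congr trig; apply/funext => t; rewrite /csub /cmul mulN1r.
Qed.

Lemma trigX p k : trig p -> trig (fun t => p t ^+ k).
Proof.
move=> tp; elim: k => [|k IH]; first exact: trig_cst.
have := trigM tp IH; congr trig; apply/funext => t.
by rewrite /cmul exprS.
Qed.

Lemma trig_cos x0 : trig (fun t => (cos (t - x0))%:C).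
Proof.
have := trigM (trig_cst 2^-1) (trigD (trigM (trig_cst (e (-1) x0)) (trig_monomial 1))
  (trigM (trig_cst (e 1 x0)) (trig_monomial (-1)))).
congr trig; apply/funext => t; rewrite /cmul /monomial !mulrN1z !mulr1z !mulN1r !mul1r !cosN !sinN cosB.
have -> : 2^-1 = (2^-1)%:C :> R[i] by rewrite fmorphV rmorphMn.
apply/eqP; rewrite eq_complex/=; apply/andP; split; apply/eqP; last by ring.
by field.
Qed.

Lemma trig_kern (a0 x0 : R) (k n : nat) : trig (fun t => (kern a0 x0 k n t)%:C).
Proof.
have t1 := trigM (trig_cst a0%:C) (trigB (trig_cst 1) (trig_cos x0)).
have := trigX (k ^ n) (trigB (trig_cst 1) (trigX n t1)).
congr trig; apply/funext => t; rewrite /kern /csub /cmul.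
by rewrite rmorphXn rmorphB rmorphXn rmorphM rmorphB !rmorph1.
Qed.

Lemma toL2_mulby a : multiplier a -> toL2 a = mulby a (E 0).
Proof.
move=> ma; apply: L2val_inj => t; rewrite mulbyE//.
rewrite (toL2K (multiplier_L2 ma)) (toL2K (multiplier_L2 (multiplier_monomial R 0))).
by rewrite monomial0 /cmul mulr1.
Qed.

(** Real [p] suffice because the kernels are real: for [p] a kernel, the form is the integral of [f]
    against the squared kernel, as [ae_norm_le] requires. *)
Lemma ae_le_of_trig_forms f (rho : R) : 0 <= rho ->
  (forall p, trig p -> cconj p = p ->
     nsq (l2 R (mulby p f) (toL2 p)) <= (rho * sq (l2 R) (toL2 p)) ^+ 2) ->
  {ae m, forall t, sqmod (L2val f) t <= rho ^+ 2}.
Proof.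
move=> rho0 H.
have [i1 i2] : cintegrable (L2val f).
  have := cintegrable_mul (L2val_L2 f) (L2_cst 1); congr cintegrable.
  by apply/funext => t; rewrite /cmul mulr1.
have h : {ae m, forall t, Num.sqrt (complex.Re (L2val f t) ^+ 2 + complex.Im (L2val f t) ^+ 2) <= rho}.
  apply: ae_norm_le => // w1 w2 a0 x0 k n a00 a01.
  pose p : cfun R := fun t => (kern a0 x0 k n t)%:C.
  have tp : trig p by exact: trig_kern.
  have mp : multiplier p by case: tp.
  have pc : cconj p = p by apply/funext => t; rewrite /cconj conjc_real.
  have := H p tp pc.
  have S : sq (l2 R) (toL2 p) = \int[m]_t (1 * kern a0 x0 k n t ^+ 2).
    rewrite sq_int toL2K; last exact: multiplier_L2.
    by apply: eq_Rintegral => t _; rewrite mul1r /sqmod /nsq/= expr0n addr0.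
  have Z : l2 R (mulby p f) (toL2 p) =
      (\int[m]_t (complex.Re (L2val f t) * kern a0 x0 k n t ^+ 2)) +i*
      (\int[m]_t (complex.Im (L2val f t) * kern a0 x0 k n t ^+ 2)).
    rewrite -[LHS]/(inner_prod _ _) mulbyE// toL2K; last exact: multiplier_L2.
    rewrite /inner_prod pc /cintegral; congr (_ +i* _); apply: eq_Rintegral => t _;
      by rewrite /cmul /p; case: (L2val f t) => x y /=; ring.
  have j1 := integrable_kern x0 k n a00 a01 i1; have j2 := integrable_kern x0 k n a00 a01 i2.
  rewrite Z S /nsq /=; 
  set I1 := \int[m]_t (complex.Re (L2val f t) * kern a0 x0 k n t ^+ 2).
  set I2 := \int[m]_t (complex.Im (L2val f t) * kern a0 x0 k n t ^+ 2).
  set T := \int[m]_t (1 * kern a0 x0 k n t ^+ 2) => h.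
  have T0 : 0 <= T by apply: Rintegral_ge0 => t _; rewrite mul1r sqr_ge0.
  have -> : \int[m]_t ((w1 * complex.Re (L2val f t) + w2 * complex.Im (L2val f t)) * kern a0 x0 k n t ^+ 2)
     = w1 * I1 + w2 * I2.
    rewrite -!RintegralZl// -RintegralD//; [|exact: (integrableZl measurableT w1 j1)|exact: (integrableZl measurableT w2 j2)].
    by apply: eq_Rintegral => t _; ring.
  rewrite mulrAC; apply: le_trans (ler_norm _) _.
  rewrite -(@ler_pXn2r _ 2)// ?nnegrE ?mulr_ge0 ?sqrtr_ge0//.
  rewrite real_normK ?num_real// exprMn sqr_sqrtr ?addr_ge0 ?sqr_ge0//.
  apply: le_trans (_ : (I1 ^+ 2 + I2 ^+ 2) * (w1 ^+ 2 + w2 ^+ 2) <= _); last first.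
    by rewrite ler_wpM2r// addr_ge0 ?sqr_ge0.
  (* Lagrange's identity, that is, Cauchy-Schwarz in the plane. *)
  rewrite -subr_ge0 (_ : _ - _ = (w1 * I2 - w2 * I1) ^+ 2) ?sqr_ge0//; ring.
apply: filterS h => t h.
rewrite -[sqmod _ _]sqr_sqrtr ?sqmod_ge0// ler_pXn2r ?nnegrE ?sqrtr_ge0//.
Qed.

Lemma fcoef_eq0 f : (forall n, fcoef f n = 0) -> sq (l2 R) f = 0.
Proof.
move=> f0; apply/sq_ae0.
have : {ae m, forall t, sqmod (L2val f) t <= 0 ^+ 2}.
  apply: ae_le_of_trig_forms => // p tp pc; rewrite mul0r expr0n.
  have mp : multiplier p by case: tp.
  rewrite (toL2_mulby mp).
  rewrite -{2}pc -mulby_adj// mulbyA// -/(fcoef _ 0).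
  have [_ [K pK]] := trigM tp tp.
  (* All coefficients of f vanish, so any threshold is admissible; 1 + K is large enough for
     frequency 0 to stay below it after a loss of K. *)
  rewrite ((pK f (1 + K%:Z)).1 _ 0) //; last by lia.
  by rewrite /nsq/= expr0n addr0.
apply: filterS => t; rewrite expr0n => h; apply: nsq_eq0; apply/eqP.
by rewrite eq_le h nsq_ge0.
Qed.

End trigonometric.

(** * Hardy space and Hankel forms *)

Section hardy.
Variable R : realType.
Notation m := (circle_measure R).
Notation V := (L2fun R).
Notation e := (@monomial R).
Notation ip := (l2 R).
Notation sq := (sq (l2 R)).
Notation E := (@fourier_basis R).
Implicit Types (f g : V) (a b p : cfun R) (n : int).

Lemma orthogonal_linear (G : set V) : linear_set [set f | forall g, G g -> ip f g = 0].
Proof.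
split=> [g _|c f g hf hg k Gk]; first exact: ip0l.
by rewrite ipDl ipZl hf// hg// mulr0 addr0.
Qed.

Lemma orthogonal_closed (G : set V) : closed_inner ip [set f | forall g, G g -> ip f g = 0].
Proof.
move=> f_ f hf cf g Gg; apply: nsq_eq0; apply/eqP; rewrite eq_le nsq_ge0 andbT.
have L1 : nsq (ip f g) @[n --> \oo] --> nsq (ip f g) by exact: cvg_cst.
have L2 : sq (f_ n - f) * sq g @[n --> \oo] --> 0 * sq g by exact: cvgMr_tmp.
rewrite -(mul0r (sq g)); apply: (ler_cvg_to L1 L2); apply: nearW => n.
by apply: le_trans (cauchy_schwarz _ _ _); rewrite ipBl hf// sub0r nsqN.
Qed.

Definition hardy : set V := [set f | forall n, n < 0 -> fcoef f n = 0].
Definition cohardy : set V := [set f | forall n, 0 <= n -> fcoef f n = 0].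

Lemma hardyE : hardy = [set f | forall g, [set E n | n in [set n : int | n < 0]] g -> ip f g = 0].
Proof.
apply/seteqP; split=> f hf; first by move=> _ [n n0 <-]; exact: hf.
by move=> n n0; apply: hf; exists n.
Qed.

Lemma hardy_linear : linear_set hardy.
Proof. by rewrite hardyE; exact: orthogonal_linear. Qed.

Lemma hardy_closed : closed_inner ip hardy.
Proof. by rewrite hardyE; exact: orthogonal_closed. Qed.

Lemma cohardy_linear : linear_set cohardy.
Proof.
split=> [n _|c f g hf hg n n0]; first exact: ip0l.
by rewrite fcoefD fcoefZ hf// hg// mulr0 addr0.
Qed.

Lemma hardy_E n : 0 <= n -> hardy (E n).
Proof. by move=> n0 k k0; rewrite fcoef_E; case: eqP => // nk; lia. Qed.

Lemma hardy_projection : exists P : V -> V, forall f,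
  hardy (P f) /\ forall h, hardy h -> ip (f - P f) h = 0.
Proof.
have /choice[P PP] : forall f, exists g, hardy g /\ forall h, hardy h -> ip (f - g) h = 0.
  move=> f; exact: (projection_exists f (@l2_complete R) hardy_linear hardy_closed).
by exists P.
Qed.

(** Both spaces are defined by single coefficients, so their orthogonality rests on completeness:
    the projection of g onto [hardy] has all coefficients zero, hence is null. *)
Lemma hardy_cohardy f g : hardy f -> cohardy g -> ip f g = 0.
Proof.
move=> Hf Hg; have [P PP] := hardy_projection; have [HP gP] := PP g.
have P0 : sq (P g) = 0.
  apply: fcoef_eq0 => n; case: (ltrP n 0) => n0; first exact: HP.
  have := gP _ (hardy_E n0); rewrite ipBl -!/(fcoef _ _) Hg// sub0r.
  by move/eqP; rewrite oppr_eq0 => /eqP.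
rewrite -[g](subrK (P g)) ipDr (sq_null_ipr _ P0) addr0 -(ipC ip).
by rewrite gP// conjc0.
Qed.

Definition analytic a := multiplier a /\ hardy (toL2 a).

Lemma analytic_cst (c : R[i]) : analytic (fun=> c).
Proof.
split; first exact: multiplier_cst.
move=> n n0; rewrite (toL2_mulby (multiplier_cst c)) mulby_cst fcoefZ.
by rewrite hardy_E ?mulr0.
Qed.

Lemma conj_analytic_cohardy a n : analytic a -> n < 0 -> cohardy (mulby (cconj a) (E n)).
Proof.
move=> [ma Ha] n0 k k0; rewrite /fcoef -(ipC ip) -mulby_adj//.
rewrite -[k]addr0 -mulby_E mulbyC//; last exact: multiplier_monomial.
rewrite -/(fcoef _ _) fcoef_mon -toL2_mulby// Ha ?conjc0//; lia.
Qed.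

(** By duality: a negative coefficient of a f pairs f with conj(a) E_n, which is in [cohardy]. No
    convolution formula for Fourier coefficients is involved. *)
Lemma analytic_mul a f : analytic a -> hardy f -> hardy (mulby a f).
Proof.
move=> aa Hf n n0; rewrite /fcoef mulby_adj; last by case: aa.
by apply: hardy_cohardy => //; exact: conj_analytic_cohardy.
Qed.

(** The norm bound rho for the Hankel operator f |-> (1 - P)(a f), stated through its sesquilinear
    form so that no projection has to be chosen. *)
Definition hankel_bound a (rho : R) := forall f g, hardy f -> cohardy g ->
  nsq (ip (mulby a f) g) <= rho ^+ 2 * sq f * sq g.

(** Moving [e (-1)] to the second argument, the new form pairs (a - x) f with functions of frequency
    at most 0. One row is added to the Hankel matrix, and x enters it only through the coefficient
    of f at 0. On f without that coefficient the row is already bounded, because a Hankel form is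
    invariant under shifts. *)
Lemma hankel_step a rho : multiplier a -> 0 <= rho -> hankel_bound a rho ->
  exists x, hankel_bound (cmul (e (-1)) (csub a (fun=> x))) rho.
Proof.
move=> ma rho0 Ha; have [P PP] := hardy_projection.
pose K f := f - P f.
have HP f : hardy (P f) by case: (PP f).
have KH f h : hardy h -> ip (K f) h = 0 by move=> Hh; case: (PP f) => _; exact.
have Kc f : cohardy (K f) by move=> n n0; apply: KH; exact: hardy_E.
(* [P] picks representatives, so [K] is linear only up to null vectors: the discrepancy lies in both
   [hardy] and [cohardy]. *)
have KL c f d g : sq (K (c *: f + d *: g)) = sq (c *: K f + d *: K g).
  apply: sq_congr; set x := _ - _.
  have xE : x = c *: P f + d *: P g - P (c *: f + d *: g).
    rewrite /x /K !scalerBr; set u := c *: f; set v := d *: g.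
    by rewrite addrACA -opprD opprB [LHS]addrC addrA subrK.
  have xH : hardy x.
    rewrite xE; apply: (linear_setB hardy_linear) => //.
    by apply: (linear_setD hardy_linear); apply: (linear_setZ _ hardy_linear).
  have xc : cohardy x.
    apply: (linear_setB cohardy_linear) => //.
    by apply: (linear_setD cohardy_linear); apply: (linear_setZ _ cohardy_linear).
  by rewrite /sq hardy_cohardy.
have ipK f g : cohardy g -> ip f g = ip (K f) g.
  by move=> cg; rewrite /K ipBl (hardy_cohardy (HP f) cg) subr0.
have bound S f g : hardy f -> cohardy g -> ip (mulby a f) g = S%:C -> sq g = S ->
    S <= rho ^+ 2 * sq f.
  move=> Hf cg iS gS; have := Ha _ _ Hf cg; rewrite iS gS nsqR.
  have [->|S0] := eqVneq S 0; first by rewrite mulr_ge0 ?sqr_ge0 ?sq_ge0.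
  have Sp : 0 < S by rewrite lt_def S0 -gS sq_ge0.
  by rewrite expr2 ler_pM2r.
(* The room that the negative frequencies of a f leave for the entry of the new row at f. *)
pose q f := rho ^+ 2 * sq f - sq (K (mulby a f)).
have [|||||||||x hx] := @corner_completion R V hardy q (fun f => fcoef f 0) (fun f => fcoef (mulby a f) 0) (E 0).
- exact: hardy_linear.
- move=> f Hf; rewrite subr_ge0; apply: (bound _ _ (K (mulby a f))) => //.
  by rewrite ipK// ip_sq.
- move=> c f Hf; rewrite /q mulbyZ// sqZ mulrBr mulrCA; congr (_ - _).
  by rewrite -[c *: _]addr0 -{1}(scale0r 0) KL !scale0r addr0 sqZ.
- move=> t f g Hf Hg; rewrite /q mulbyD// !mulbyZ// KL !sq_convex.
  have -> : sq (K (mulby a (f - g))) = sq (K (mulby a f) - K (mulby a g)).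
    by rewrite mulbyB// -[in LHS](scale1r (mulby a f)) -scaleN1r KL scale1r scaleN1r.
  ring.
- by move=> c f g; rewrite fcoefD fcoefZ.
- by move=> c f g; rewrite mulbyD// mulbyZ// fcoefD fcoefZ.
- exact: hardy_E.
- by rewrite fcoef_E.
(* Since h has no constant term, [e (-1)] keeps it in [hardy]; it also carries [W], the part of a h
   of frequency at most 0, into [cohardy]. The old bound on these two shifts is the required
   inequality. *)
- move=> h Hh h0; rewrite /q; set c := fcoef _ 0; set k := K _.
  pose W := c *: E 0 + k.
  have Ek : ip (E 0) k = 0 by apply: hardy_cohardy; [exact: hardy_E|exact: Kc].
  have SW : sq W = nsq c + sq k.
    rewrite sqD sqZ sq_E mulr1 ipZl Ek mulr0 mulr0 addr0//.
  rewrite lerBrDr -(sq_mon (-1) h); apply: (bound _ _ (mulby (e (-1)) W)).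
  + move=> n n0; rewrite fcoef_mon opprK.
    by have [->|n1] := eqVneq (n + 1) 0; [exact: h0|apply: Hh; lia].
  + move=> n n0; rewrite fcoef_mon opprK fcoefD fcoefZ fcoef_E Kc ?addr0; last by lia.
    by case: eqP => [|_]; [lia|rewrite mulr0].
  + rewrite mulbyC//; last exact: multiplier_monomial.
    rewrite ip_mon mulby_mon opprK subrr mulby_mon0 ipDr ipZr -/(fcoef _ 0) -/c.
    by rewrite mulrC nsqJ ipK; [rewrite ip_sq -rmorphD|exact: Kc].
  + by rewrite sq_mon.
exists x => f g Hf cg.
have mx : multiplier (fun=> x) by exact: multiplier_cst.
have mm := multiplier_monomial R.
rewrite -mulbyA//; last exact: multiplierB.
rewrite ip_mon opprK mulby_sub// mulby_cst.
(* The shifted g splits into the new direction [E 0] and a vector of [cohardy]; against it, (a - x)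
   f acts as b E_0 + k, whose norm is what the choice of x controls. *)
set G := mulby (e 1) g; set c := fcoef G 0.
have [G' cG' GE] : exists2 G', cohardy G' & G = c *: E 0 + G'.
  exists (G - c *: E 0); last by rewrite addrC subrK.
  move=> n n0; rewrite fcoefB fcoefZ fcoef_E; case: eqP => [<-|n0']; first by rewrite mulr1 subrr.
  by rewrite mulr0 subr0 fcoef_mon cg//; lia.
set b := fcoef (mulby a f) 0 - x * fcoef f 0; have := ipK (mulby a f); have := hx f Hf.
rewrite -/b /q; move: (Kc (mulby a f)); move: (K (mulby a f)) => k ck hk ipk.
have HE0 : hardy (E 0) by exact: hardy_E.
have -> : ip (mulby a f - x *: f) G = ip (b *: E 0 + k) G.
  rewrite GE ipBl !ipDr !ipDl !ipZr !ipZl -!/(fcoef _ 0) (fcoef_E R 0 0) eqxx mulr1.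
  rewrite (hardy_cohardy HE0 cG') (hardy_cohardy Hf cG') (ipk _ cG') (ck 0)//.
  by rewrite !mulr0 !addr0 add0r /b mulrBr addrAC.
have sk : sq (b *: E 0 + k) <= rho ^+ 2 * sq f.
  rewrite sqD sqZ sq_E mulr1 ipZl (hardy_cohardy HE0 ck) mulr0 mulr0 addr0.
  by rewrite -lerBrDr.
apply: le_trans (cauchy_schwarz _ _ _) _.
by rewrite sq_mon ler_wpM2r// sq_ge0.
Qed.

End hardy.

(** * Nehari's theorem *)

Section nehari.
Variable R : realType.
Notation m := (circle_measure R).
Notation V := (L2fun R).
Notation e := (@monomial R).
Notation ip := (l2 R).
Notation sq := (sq (l2 R)).
Notation nrm := (nrm (l2 R)).
Notation E := (@fourier_basis R).
Implicit Types (f g : V) (a b p : cfun R) (n : int).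

Lemma toL2D a b : multiplier a -> multiplier b -> toL2 (fun t => a t + b t) = toL2 a + toL2 b.
Proof.
by move=> ma mb; rewrite !toL2_mulby ?mulby_add//; exact: multiplierD.
Qed.

Lemma toL2B a b : multiplier a -> multiplier b -> toL2 (csub a b) = toL2 a - toL2 b.
Proof.
by move=> ma mb; rewrite !toL2_mulby ?mulby_sub//; exact: multiplierB.
Qed.

Section iteration.
Variables (X : cfun R -> R[i]) (psi : cfun R) (rho : R).
Hypothesis mpsi : multiplier psi.
Hypothesis rho0 : 0 <= rho.
Hypothesis XP : forall a, multiplier a -> hankel_bound a rho ->
  hankel_bound (cmul (e (-1)) (csub a (fun=> X a))) rho.
Hypothesis psi_bound : hankel_bound psi rho.

(** Its Hankel form is that of psi - a with second arguments of frequency below k in place of 0. *)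
Let shifted (k : nat) a := cmul (e (- k%:Z)) (csub psi a).

(* Taylor partial sums of the analytic function to be subtracted from [psi]. *)
Fixpoint nehari_poly (k : nat) : cfun R :=
  if k is k'.+1 then
    fun t => nehari_poly k' t + X (shifted k' (nehari_poly k')) * e k' t
  else fun=> 0.
Let q := nehari_poly.
Let x k := X (shifted k (q k)).

Lemma nehari_poly_multiplier k : multiplier (q k).
Proof.
elim: k => [|k IH]; first exact: multiplier_cst.
apply: multiplierD => //; apply: (@multiplierM _ (fun=> _)); first exact: multiplier_cst.
exact: multiplier_monomial.
Qed.
Let mq := nehari_poly_multiplier.

Lemma shifted_multiplier k : multiplier (shifted k (q k)).
Proof. by apply: multiplierM; [exact: multiplier_monomial|exact: multiplierB]. Qed.

Lemma nehari_poly_bound k : hankel_bound (shifted k (q k)) rho.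
Proof.
elim: k => [|k IH].
  rewrite (_ : shifted _ _ = psi)//; apply/funext => t.
  by rewrite /shifted /cmul /csub oppr0 monomial0 mul1r subr0.
have := XP (shifted_multiplier k) IH; congr hankel_bound; apply/funext => t.
rewrite /shifted /cmul /csub /= -/(q k) -/(x k).
rewrite (_ : - k.+1%:Z = -1 + - k%:Z); last by lia.
rewrite -monomialD -mulrA; congr (_ * _).
rewrite opprD addrA [RHS]mulrBr; congr (_ - _).
by rewrite mulrCA monomialD addNr monomial0 mulr1.
Qed.

Let Q k := toL2 (q k).

Lemma nehari_polyS k : Q k.+1 = Q k + x k *: E k.
Proof.
rewrite /Q /= toL2D//; last first.
  by apply: (@multiplierM _ (fun=> _)); [exact: multiplier_cst|exact: multiplier_monomial].
congr (_ + _); rewrite toL2_mulby; last first.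
  by apply: (@multiplierM _ (fun=> _)); [exact: multiplier_cst|exact: multiplier_monomial].
rewrite -(@mulbyA _ (fun=> _)); [|exact: multiplier_cst|exact: multiplier_monomial].
by rewrite mulby_cst mulby_E addr0.
Qed.

Lemma nehari_poly_support k n : n < 0 \/ k%:Z <= n -> fcoef (Q k) n = 0.
Proof.
elim: k => [|k IH] h.
  rewrite /Q (_ : toL2 _ = 0); first exact: ip0l.
  by apply: L2val_inj => t; rewrite toL2K//; exact: L2_cst.
rewrite nehari_polyS fcoefD fcoefZ fcoef_E IH; last by lia.
by case: eqP => [|_]; [lia|rewrite mulr0 addr0].
Qed.

Lemma nehari_poly_diff_support k l n : (k <= l)%N -> n < k%:Z -> fcoef (Q l - Q k) n = 0.
Proof.
move=> kl nk; rewrite -(subnK kl); elim: (l - k)%N => [|j IH].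
  by rewrite add0n subrr /fcoef ip0l.
rewrite addSn nehari_polyS addrAC fcoefD IH add0r fcoefZ fcoef_E.
by case: eqP => [|_]; [lia|rewrite mulr0].
Qed.

Lemma nehari_poly_hardy k : hardy (Q k).
Proof. by move=> n n0; apply: nehari_poly_support; left. Qed.

Lemma nehari_poly_cohardy k : cohardy (mulby (e (- k%:Z)) (Q k)).
Proof. by move=> n n0; rewrite fcoef_mon nehari_poly_support//; right; lia. Qed.

(** Frequencies at least k against frequencies below k: shifting by -k reduces their orthogonality
    to [hardy_cohardy]. *)
Lemma nehari_poly_pythagoras k l : (k <= l)%N -> sq (Q l - Q k) = sq (Q l) - sq (Q k).
Proof.
move=> kl.
have o : ip (Q l - Q k) (Q k) = 0.
  have -> : ip (Q l - Q k) (Q k) = ip (mulby (e (- k%:Z)) (Q l - Q k)) (mulby (e (- k%:Z)) (Q k)).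
    by rewrite ip_mon mulby_mon opprK subrr mulby_mon0.
  apply: hardy_cohardy; last exact: nehari_poly_cohardy.
  by move=> n n0; rewrite fcoef_mon nehari_poly_diff_support//; lia.
by rewrite -[in RHS](subrK (Q k) (Q l)) [in RHS]sqD o /= mulr0 addr0 addrK.
Qed.

(** The k-th Hankel bound, tested on 1 and on [Q k] shifted by -k, reads |<psi - Q_k, Q_k>| <= rho
    |Q_k|. Hence |Q_k|^2 is at most (|psi| + rho) |Q_k|, uniformly in k. *)
Lemma nehari_poly_norm k : nrm (Q k) <= nrm (toL2 psi) + rho.
Proof.
have := nehari_poly_bound k (hardy_E R (lexx 0)) (nehari_poly_cohardy k).
rewrite sq_E mulr1 sq_mon -mulbyA; [|exact: multiplier_monomial|exact: multiplierB].
rewrite ip_mon mulby_mon opprK subrr mulby_mon0 -toL2_mulby; last exact: multiplierB.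
rewrite toL2B// ipBl -/(Q k) ip_sq; set z := _ - _ => hz.
have n0 := nrm_ge0 (l2 R) (Q k).
have zle : - complex.Re z <= rho * nrm (Q k).
  apply: (le_trans (ler_norm _)).
  rewrite -(@ler_pXn2r _ 2)// ?nnegrE ?mulr_ge0//.
  rewrite real_normK ?num_real// sqrrN (le_trans (Re_le_nsq _))// exprMn nrm_sqr//.
have := Re_ip_le (l2 R) (toL2 psi) (Q k).
move: zle; rewrite /z ReD ReN /= -nrm_sqr => h1 h2.
have [->|Np] := eqVneq (nrm (Q k)) 0; first by rewrite addr_ge0// nrm_ge0.
have N0 : 0 < nrm (Q k) by rewrite lt_def Np.
rewrite -(ler_pM2r N0) mulrDl -expr2; lra.
Qed.

Lemma nehari_poly_cvg : exists h, sq (Q k - h) @[k --> \oo] --> (0 : R).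
Proof.
apply: l2_complete => d d0.
have nd : nondecreasing_seq (fun k => sq (Q k)).
  by move=> k l kl; rewrite -subr_ge0 -nehari_poly_pythagoras// sq_ge0.
have cv : cvgn (fun k => sq (Q k)).
  apply: nondecreasing_is_cvgn => //.
  exists ((nrm (toL2 psi) + rho) ^+ 2) => _ [k _ <-].
  rewrite -nrm_sqr ler_pXn2r ?nnegrE ?nrm_ge0 ?addr_ge0 ?nrm_ge0//.
  exact: nehari_poly_norm.
have ub := nondecreasing_cvgn_le nd cv.
have dl : limn (fun k => sq (Q k)) - d < limn (fun k => sq (Q k)) by rewrite ltrBlDr ltrDl.
have [N _ HN] := cvgr_gt _ cv _ dl.
exists N; have H i j : (N <= i)%N -> (i <= j)%N -> sq (Q j - Q i) <= d.
  move=> Ni ij; rewrite nehari_poly_pythagoras// lerBlDr.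
  apply: le_trans (ub j) _; rewrite -lerBlDl; exact/ltW/HN.
move=> i j Ni Nj; case: (leqP i j) => ij; first by rewrite sqBC; exact: H.
by apply: H => //; exact: ltnW.
Qed.

Lemma nehari_solution : exists2 h, hardy h &
  {ae m, forall t, sqmod (L2val (toL2 psi - h)) t <= rho ^+ 2}.
Proof.
have [h hQ] := nehari_poly_cvg.
have Hh : hardy h by apply: (@hardy_closed R Q) => // k; exact: nehari_poly_hardy.
have tail k n : n < k%:Z -> fcoef (h - Q k) n = 0.
  move=> nk; apply: (@orthogonal_closed R [set E n] (fun l => Q (l + k)%N - Q k)) => //.
    by move=> l g ->; apply: nehari_poly_diff_support => //; exact: leq_addl.
  rewrite (_ : (fun l => _) = (fun l => sq (Q (l + k)%N - h))).
    by rewrite (cvg_shiftn k (fun l => sq (Q l - h) : R^o)).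
  by apply/funext => l; congr (sq _); rewrite opprB addrA subrK.
exists h => //; apply: ae_le_of_trig_forms => // p tp pc.
have mp : multiplier p by case: tp.
have [_ [K pK]] := tp.
(* The product p P has frequencies at most 2 K, so the tail h - Q_k, supported from k = 2 K + 1 on,
   does not contribute and h may be replaced by [Q k]. *)
set P := toL2 p; pose k := (K + K).+1.
have PE : P = mulby p (E 0) by exact: toL2_mulby.
have lowP n : n < - K%:Z -> fcoef P n = 0.
  move=> nK; rewrite PE; apply: ((pK (E 0) 0).1 _ n _); last by lia.
  exact: hardy_E.
have upP n : K%:Z < n -> fcoef P n = 0.
  move=> nK; rewrite PE; apply: ((pK (E 0) 0).2 _ n _); last by lia.
  by move=> j j0; rewrite fcoef_E; case: eqP => // j0'; lia.
have upPP n : K%:Z + K%:Z < n -> fcoef (mulby p P) n = 0.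
  by move=> nK; apply: ((pK P K%:Z).2 upP n); lia.
have -> : ip (mulby p (toL2 psi - h)) P = ip (mulby p (toL2 psi - Q k)) P.
  apply/eqP; rewrite -subr_eq0 -ipBl -mulbyB// opprB addrC addrA subrK.
  rewrite -[Q k - h]opprB mulbyN// ipNl oppr_eq0 mulby_adj// pc.
  have -> : ip (h - Q k) (mulby p P) = ip (mulby (e (- k%:Z)) (h - Q k)) (mulby (e (- k%:Z)) (mulby p P)).
    by rewrite ip_mon mulby_mon opprK subrr mulby_mon0.
  rewrite hardy_cohardy//.
    by move=> n n0; rewrite fcoef_mon tail//; lia.
  by move=> n n0; rewrite fcoef_mon upPP//; lia.
have -> : mulby p (toL2 psi - Q k) = mulby (csub psi (q k)) P.
  rewrite -toL2B// [toL2 (csub _ _)]toL2_mulby; last exact: multiplierB.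
  by rewrite [LHS]mulbyC -?PE//; exact: multiplierB.
(* Shifts by K and by K - k = - K - 1 put the same [P] into the two spaces. Together with the shift
   by -k in the symbol they cancel, leaving the form of psi - q_k at (P, P). *)
have HF : hardy (mulby (e K) P) by move=> n n0; rewrite fcoef_mon lowP//; lia.
have HG : cohardy (mulby (e (K%:Z - k%:Z)) P).
  by move=> n n0; rewrite fcoef_mon upP//; lia.
have := nehari_poly_bound k HF HG.
rewrite !sq_mon -mulbyA; [|exact: multiplier_monomial|exact: multiplierB].
rewrite [mulby (csub _ _) _]mulbyC; [|exact: multiplierB|exact: multiplier_monomial].
rewrite mulby_mon ip_mon mulby_mon opprD opprK (_ : _ + _ = 0); last by lia.
by rewrite mulby_mon0 exprMn -mulrA -expr2.
Qed.

End iteration.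

Theorem nehari psi rho : multiplier psi -> 0 <= rho -> hankel_bound psi rho ->
  exists2 h, analytic h & {ae m, forall t, sqmod (csub psi h) t <= rho ^+ 2}.
Proof.
move=> mpsi rho0 Hpsi.
have /choice[X XP] : forall a, exists x, multiplier a -> hankel_bound a rho ->
    hankel_bound (cmul (e (-1)) (csub a (fun=> x))) rho.
  move=> a; have [[ma Ha]|na] := pselect (multiplier a /\ hankel_bound a rho).
    by have [x Hx] := hankel_step ma rho0 Ha; exists x.
  by exists 0 => ma Ha; case: na.
have [h Hh hle] := nehari_solution mpsi rho0 XP Hpsi.
have E t : L2val (toL2 psi - h) t = csub psi (L2val h) t.
  by rewrite L2valB toL2K//; exact: multiplier_L2.
exists (L2val h : cfun R).
  split; last by rewrite toL2val.
  split; first by have [] := (L2P _).1 (L2val_L2 h).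
  (* The solution is bounded because |h|^2 <= 2 (|psi|^2 + |psi - h|^2). *)
  have [_ [M psiM]] := mpsi; exists (2 * (M + rho ^+ 2)).
  apply: filterS2 hle psiM => t; rewrite /sqmod /nsq E /csub => h1 h2.
  move: h1 h2; case: (psi t) => a b; case: (L2val h t) => c d /= h1 h2.
  apply: le_trans (_ : 2 * (a ^+ 2 + b ^+ 2 + ((a - c) ^+ 2 + (b - d) ^+ 2)) <= _).
    rewrite -subr_ge0 (_ : _ - _ = (a + (a - c)) ^+ 2 + (b + (b - d)) ^+ 2); last by ring.
    by rewrite addr_ge0// sqr_ge0.
  by rewrite ler_wpM2l// lerD.
by apply: filterS hle => t; rewrite /sqmod /nsq E.
Qed.

End nehari.

(** * Model spaces *)

Section translation.
Variable R : realType.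
Notation m := (circle_measure R).
Notation V := (L2fun R).
Notation e := (@monomial R).
Notation ip := (l2 R).
Notation sq := (sq (l2 R)).
Notation nrm := (nrm (l2 R)).
Notation E := (@fourier_basis R).
Implicit Types (f g : V) (a b p : cfun R) (n : int).

Lemma Lnorm_infty a : ('N[m]_+oo[cmodulus a] = ess_sup m (cmodulus a))%E.
Proof.
rewrite unlock /Lnorm ifT; last first.
  by rewrite [X in (_ < X)%E](_ : _ = 1%E) ?lte_fin ?ltr01//; exact: probability_setT.
congr (ess_sup m); apply/funext => t.
by rewrite /comp gee0_abs// cmodulusE lee_fin sqrtr_ge0.
Qed.

Lemma sqrt_sqmod_le a (M : R) t : 0 <= M ->
  (Num.sqrt (sqmod a t) <= M) = (sqmod a t <= M ^+ 2).
Proof.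
move=> M0; rewrite -(@ler_pXn2r _ 2)// ?nnegrE ?sqrtr_ge0//.
by rewrite sqr_sqrtr ?sqmod_ge0.
Qed.

Lemma norm_infty_ge0 a : 0 <= norm_infty a.
Proof. by rewrite fine_ge0// Lnorm_ge0. Qed.

Lemma LinftyP a : Linfty a <-> multiplier a.
Proof.
rewrite /Linfty /Lp /mkset Lnorm_infty; split=> -[ma].
  move=> al; split => //.
  have : (0 <= ess_sup m (cmodulus a))%E by rewrite -Lnorm_infty Lnorm_ge0.
  have := ess_sup_ge m (cmodulus a); move: al.
  case: (ess_sup m _) => [M| |] // _ aM; rewrite lee_fin => M0.
  exists (M ^+ 2); apply: filterS aM => t.
  by rewrite cmodulusE lee_fin sqrt_sqmod_le.
move=> [M aM]; split=> //; apply: (@le_lt_trans _ _ (Num.sqrt M)%:E); last exact: ltry.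
apply/ess_supP; apply: filterS aM => t aM.
by rewrite cmodulusE lee_fin ler_wsqrtr.
Qed.

Lemma norm_infty_ae a : multiplier a ->
  {ae m, forall t, sqmod a t <= norm_infty a ^+ 2}.
Proof.
move=> /LinftyP[ma]; have := norm_infty_ge0 a; rewrite /norm_infty Lnorm_infty.
have : (0 <= ess_sup m (cmodulus a))%E by rewrite -Lnorm_infty Lnorm_ge0.
have := ess_sup_ge m (cmodulus a).
case: (ess_sup m _) => [M| |] //= aM _ M0 _; apply: filterS aM => t.
by rewrite cmodulusE lee_fin sqrt_sqmod_le.
Qed.

Lemma norm_infty_le a (M : R) : 0 <= M -> {ae m, forall t, sqmod a t <= M ^+ 2} ->
  norm_infty a <= M.
Proof.
move=> M0 aM; rewrite /norm_infty Lnorm_infty.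
have h : (ess_sup m (cmodulus a) <= M%:E)%E.
  apply/ess_supP; apply: filterS aM => t aM.
  by rewrite cmodulusE lee_fin sqrt_sqmod_le.
have h0 : (0 <= ess_sup m (cmodulus a))%E by rewrite -Lnorm_infty Lnorm_ge0.
by move: h h0; case: (ess_sup m _) => //= r; rewrite !lee_fin.
Qed.

Lemma essinf_modulus_ge0 a : 0 <= essinf_modulus a.
Proof.
apply: fine_ge0; apply/ess_infP; apply: aeW => t.
by rewrite cmodulusE lee_fin sqrtr_ge0.
Qed.

Lemma essinf_modulus_ae a : {ae m, forall t, essinf_modulus a ^+ 2 <= sqmod a t}.
Proof.
have h0 := essinf_modulus_ge0 a.
have : {ae m, forall t, essinf_modulus a <= Num.sqrt (sqmod a t)}.
  move: h0; rewrite /essinf_modulus.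
  have := ess_inf_le m (cmodulus a); case: (ess_inf m _) => [r| |] /= ar _.
  - by apply: filterS ar => t; rewrite cmodulusE lee_fin.
  (* An infinite essential infimum is sent to 0 by [fine], and the bound becomes trivial. *)
  - by apply: aeW => t; exact: sqrtr_ge0.
  - by apply: aeW => t; exact: sqrtr_ge0.
apply: filterS => t h; rewrite -[leRHS]sqr_sqrtr ?sqmod_ge0//.
by rewrite ler_pXn2r ?nnegrE ?sqrtr_ge0.
Qed.

Lemma inner_prod_ip a b : L2 a -> L2 b -> inner_prod a b = ip (toL2 a) (toL2 b).
Proof. by move=> La Lb; rewrite -[RHS]/(inner_prod _ _) !toL2K. Qed.

Lemma H2P a : H2 a <-> L2 a /\ hardy (toL2 a).
Proof.
have Le n : L2 (e n) by apply: multiplier_L2; exact: multiplier_monomial.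
split=> -[La h]; split => // n n0; have := h n n0.
  by rewrite /fourier_coef inner_prod_ip.
by rewrite /fourier_coef inner_prod_ip.
Qed.

Lemma HinftyP a : Hinfty a <-> analytic a.
Proof.
split=> [[/H2P[_ Ha] /LinftyP ma]|[ma Ha]]; first by split.
by split; [apply/H2P; split => //; exact: multiplier_L2|apply/LinftyP].
Qed.

Lemma normc_sqmod a t : ComplexField.Normc.normc (a t) = 1 -> sqmod a t = 1.
Proof.
rewrite -[LHS]/(fine (cmodulus a t)) cmodulusE /= => h.
by rewrite -[LHS]sqr_sqrtr ?sqmod_ge0// h expr1n.
Qed.

Lemma inner_functionP a : is_inner_function a ->
  analytic a /\ {ae m, forall t, sqmod a t = 1}.
Proof.
move=> [/HinftyP aa a1]; split => //.
by apply: filterS a1 => t; exact: normc_sqmod.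
Qed.

Definition modelV a : set V := [set f | hardy f /\ forall h, hardy h -> ip f (mulby a h) = 0].
Definition model_perpV a : set V := [set f | forall g, modelV a g -> ip f g = 0].

Lemma L2cmul a b : multiplier a -> L2 b -> L2 (cmul a b).
Proof. by move=> [ma Ma]; exact: L2M. Qed.

Lemma toL2_cmul a b : multiplier a -> L2 b -> toL2 (cmul a b) = mulby a (toL2 b).
Proof. by move=> ma Lb; rewrite /mulby toL2K. Qed.

Lemma model_spaceP a b : multiplier a -> model_space a b <-> L2 b /\ modelV a (toL2 b).
Proof.
move=> ma; split.
  move=> [/H2P[Lb Hb] ob]; split => //; split => // h Hh.
  have H2h : H2 (L2val h) by apply/H2P; rewrite toL2val; split => //; exact: L2val_L2.
  have := ob _ (ex_intro2 _ _ _ H2h erefl).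
  by rewrite inner_prod_ip//; apply: L2cmul => //; exact: L2val_L2.
move=> [Lb [Hb ob]]; split; first by apply/H2P.
move=> _ [h /H2P[Lh Hh] <-]; rewrite inner_prod_ip//; last exact: L2cmul.
by rewrite toL2_cmul// ob.
Qed.

Lemma model_space_perpP a b : multiplier a ->
  model_space_perp a b <-> L2 b /\ model_perpV a (toL2 b).
Proof.
move=> ma; split=> -[Lb ob]; split => // g.
  move=> Mg; have Lg := L2val_L2 g.
  have := ob (L2val g) ((model_spaceP (L2val g) ma).2 (conj Lg _)).
  by rewrite inner_prod_ip ?toL2val//; exact.
by move=> /(model_spaceP _ ma)[Lg Mg]; rewrite inner_prod_ip// ob.
Qed.

Lemma norm2_toL2 a : L2 a -> norm2 a = nrm (toL2 a).
Proof. by move=> La; rewrite -norm2_nrm toL2K. Qed.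

Lemma norm2_proj (Es : set (cfun R)) (F : set V) b g : linear_set F ->
  (forall c, Es c <-> L2 c /\ F (toL2 c)) -> L2 b -> F g ->
  (forall h, F h -> ip (toL2 b - g) h = 0) -> norm2 (Defs.proj Es b) = nrm g.
Proof.
move=> FL EF Lb Fg og.
have EsV h : F h -> Es (L2val h).
  by move=> Fh; apply/EF; rewrite toL2val; split => //; exact: L2val_L2.
have toL2sub c : L2 c -> toL2 (csub b c) = toL2 b - toL2 c.
  move=> Lc; apply: L2val_inj => t; rewrite L2valB !toL2K//.
  exact: L2B.
have : [set g | Es g /\ forall h, Es h -> inner_prod (csub b g) h = 0] (Defs.proj Es b).
  apply: xgetPex; exists (L2val g : cfun R); split; first exact: EsV.
  move=> h /EF[Lh Fh]; have Lg := L2val_L2 g.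
  by rewrite inner_prod_ip ?toL2sub ?toL2val ?og//; exact: L2B.
move=> [/EF[Lp Fp] op]; rewrite norm2_toL2//; congr (Num.sqrt _); apply: sq_congr.
set d := _ - g; have Fd : F d by exact: linear_setB.
have : ip d d = 0; last by rewrite /sq => ->.
rewrite {1}/d -(subrKA (toL2 b)) -[_ - toL2 b]opprB ipDl ipNl og// addr0.
have := op _ (EsV _ Fd); rewrite inner_prod_ip ?toL2sub ?toL2val//; last 2 first.
- exact: L2B.
- exact: L2val_L2.
by move=> ->; rewrite oppr0.
Qed.

End translation.

(** * The operator on the model space and its Hankel counterpart *)

Section model.
Variable R : realType.
Notation m := (circle_measure R).
Notation V := (L2fun R).
Notation e := (@monomial R).
Notation ip := (l2 R).
Notation sq := (sq (l2 R)).
Notation nrm := (nrm (l2 R)).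
Notation E := (@fourier_basis R).
Implicit Types (f g h : V) (a b p : cfun R) (n : int).

Lemma sq_orthogonal f g : ip f g = 0 -> sq (f + g) = sq f + sq g.
Proof. by move=> o; rewrite sqD o mulr0 addr0. Qed.

Variables (u phi : cfun R).
Hypotheses (au : analytic u) (u1 : {ae m, forall t, sqmod u t = 1}).
Hypothesis aphi : analytic phi.
Let mu : multiplier u := au.1.
Let mphi : multiplier phi := aphi.1.
Let mcu : multiplier (cconj u) := multiplier_conj mu.
Let psi := cmul (cconj u) phi.
Let mpsi : multiplier psi := multiplierM mcu mphi.

Lemma inner_mul_conj f : sq (mulby u (mulby (cconj u) f) - f) = 0.
Proof.
apply/sq_eq_ae; apply: filterS u1 => t u1t; rewrite !mulbyE//.
by rewrite /cmul /cconj mulrA nsqJ [nsq _]u1t mul1r.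
Qed.

Lemma inner_conj_mul f : sq (mulby (cconj u) (mulby u f) - f) = 0.
Proof. by rewrite mulbyC//; exact: inner_mul_conj. Qed.

Lemma inner_isometry f g : ip (mulby u f) (mulby u g) = ip f g.
Proof.
rewrite mulby_adj// -[mulby (cconj u) _](subrK g) ipDr.
by rewrite (sq_null_ipr _ (inner_conj_mul g)) add0r.
Qed.

Lemma sq_mul_inner f : sq (mulby u f) = sq f.
Proof. by rewrite /sq inner_isometry. Qed.

Lemma mulby_psi_inner f : sq (mulby psi (mulby u f) - mulby phi f) = 0.
Proof.
by rewrite (mulbyC _ mpsi mu) -mulbyA//; exact: inner_mul_conj.
Qed.

Lemma sq_mul_psi f : sq (mulby psi f) = sq (mulby phi f).
Proof.
rewrite /psi -mulbyA// -[LHS]sq_mul_inner; apply: sq_congr.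
exact: inner_mul_conj.
Qed.

Lemma modelV_linear : linear_set (modelV u).
Proof.
split=> [|c f g [Hf of_] [Hg og]].
  by split; [exact: (hardy_linear R).1|move=> h _; exact: ip0l].
split; first exact: (hardy_linear R).2.
by move=> h Hh; rewrite ipDl ipZl of_// og// mulr0 addr0.
Qed.

Lemma model_perpV_linear : linear_set (model_perpV u).
Proof. exact: orthogonal_linear. Qed.

Variable P : V -> V.
Hypothesis PP : forall f, hardy (P f) /\ forall h, hardy h -> ip (f - P f) h = 0.

Lemma P_unique f g : hardy g -> (forall h, hardy h -> ip (f - g) h = 0) -> sq (P f) = sq g.
Proof.
move=> Hg og; have [HP oP] := PP f; apply: sq_congr.
have Hd : hardy (P f - g) by exact: (linear_setB (hardy_linear R)).
have : ip (P f - g) (P f - g) = 0; last by rewrite /sq => ->.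
rewrite -{1}(subrKA f) -[P f - f]opprB ipDl ipNl og// oP//.
by rewrite oppr0 addr0.
Qed.

Lemma sq_split f : sq f = sq (P f) + sq (f - P f).
Proof.
have [HP oP] := PP f; rewrite addrC -sq_orthogonal ?subrK//.
exact: oP.
Qed.

Lemma norm2_B_op a : model_space u a ->
  norm2 (B_op u phi a) = nrm (P (mulby psi (toL2 a))).
Proof.
move=> /(model_spaceP _ mu)[La [Ha oa]]; set f := toL2 a.
have [HP oP] := PP (mulby psi f).
rewrite /B_op (norm2_proj (F := model_perpV u) (g := mulby u (P (mulby psi f)))).
- by rewrite /nrm sq_mul_inner.
- exact: model_perpV_linear.
- by move=> c; exact: model_space_perpP.
- exact: L2cmul.
- move=> g [Hg og]; rewrite -(ipC ip) og ?conjc0//.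
(* The remainder phi f - u P(psi f) is itself in the model space: it lies in [hardy], and its
   pairing with u g equals that of psi f - P(psi f) with g. *)
- move=> h oh; rewrite toL2_cmul// -/f.
  rewrite -(ipC ip) oh ?conjc0//; split.
    apply: (linear_setB (hardy_linear R)); first exact: analytic_mul.
    exact: analytic_mul.
  move=> g Hg.
  have E1 : ip (mulby phi f) (mulby u g) = ip (mulby u (mulby psi f)) (mulby u g).
    apply/eqP; rewrite -subr_eq0 -ipBl -oppr_eq0 -ipNl opprB; apply/eqP.
    by apply: sq_null_ip; rewrite /psi -mulbyA//; exact: inner_mul_conj.
  by rewrite ipBl E1 !inner_isometry -ipBl oP.
Qed.

Lemma norm2_toeplitz a : H2 a -> norm2 (toeplitz psi a) = nrm (P (mulby psi (toL2 a))).
Proof.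
move=> /H2P[La Ha]; have [HP oP] := PP (mulby psi (toL2 a)).
apply: (norm2_proj (F := @hardy R)).
- exact: hardy_linear.
- by move=> c; exact: H2P.
- exact: (L2cmul mpsi La).
- exact: HP.
- by move=> h Hh; rewrite toL2_cmul// oP.
Qed.

(** The coefficient at 0 is evaluation at the origin, hence multiplicative: without its constant
    term h is z times a function in [hardy], and so is u times it. *)
Lemma inner_mul_coef0 h : hardy h -> fcoef (mulby u h) 0 = fcoef (toL2 u) 0 * fcoef h 0.
Proof.
move=> Hh; set c := fcoef h 0; pose h' := h - c *: E 0.
have h'E : h = c *: E 0 + h' by rewrite addrC subrK.
have Hz : hardy (mulby (e (-1)) h').
  move=> n n0; rewrite fcoef_mon opprK fcoefB fcoefZ fcoef_E.
  case: eqP => [<-|n1]; first by rewrite mulr1 subrr.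
  by rewrite mulr0 subr0 Hh//; lia.
have -> : fcoef (mulby u h) 0 = c * fcoef (toL2 u) 0 + fcoef (mulby u h') 0.
  by rewrite {1}h'E mulbyD// mulbyZ// fcoefD fcoefZ -toL2_mulby.
rewrite (_ : fcoef (mulby u h') 0 = 0) ?addr0 1?mulrC//.
have -> : h' = mulby (e 1) (mulby (e (-1)) h') by rewrite mulby_mon subrr mulby_mon0.
rewrite mulbyC//; last exact: multiplier_monomial.
by rewrite fcoef_mon analytic_mul.
Qed.

(** The vector k = 1 - conj(u(0)) u is the reproducing kernel of the model space at the origin. This
    is where nonconstancy enters: the infimum defining the minimum modulus is taken over a nonempty
    set. *)
Lemma model_unit_vector : nonconstant u -> exists2 f, modelV u f & sq f = 1.
Proof.
move=> unc; pose c := conjc (fcoef (toL2 u) 0); pose k := E 0 - c *: toL2 u.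
have HE0 : hardy (E 0) by exact: hardy_E.
have Mk : modelV u k.
  split; first by apply: (linear_setB (hardy_linear R)) => //; apply: (linear_setZ _ (hardy_linear R)); case: au.
  move=> h Hh; rewrite ipBl ipZl (toL2_mulby mu) inner_isometry.
  by rewrite -!(ipC ip _ (E 0)) -!/(fcoef _ 0) inner_mul_coef0// conjcM subrr.
have k0 : sq k != 0.
  (* If k were null then c u = 1 a.e., with c nonzero since otherwise k is the constant 1. *)
  apply/eqP => /sq_eq_ae k0; apply: unc; exists c^-1.
  have cN : c != 0.
    apply/eqP => c0; have : sq k = 0 by apply/sq_eq_ae.
    by rewrite /k c0 scale0r subr0 sq_E => /eqP; rewrite oner_eq0.
  apply: filterS k0 => t; rewrite L2valZ (toL2K (multiplier_L2 mu)).
  rewrite (toL2K (multiplier_L2 (multiplier_monomial R 0))) monomial0 => h.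
  by rewrite -[LHS](mulKf cN) -h mulr1.
have kp : 0 < sq k by rewrite lt_def k0 sq_ge0.
exists ((nrm k)^-1%:C *: k); first exact: (linear_setZ _ modelV_linear).
by rewrite sqZ nsqR exprVn nrm_sqr mulVf.
Qed.

Lemma hankel_le h f : hardy f -> hardy h ->
  sq (mulby psi f - P (mulby psi f)) <= sq (mulby psi f - h).
Proof.
move=> Hf Hh; have [HP oP] := PP (mulby psi f).
rewrite -[in leRHS](subrKA (P (mulby psi f)) (mulby psi f) (- h)) [leRHS]sq_orthogonal; first by rewrite lerDl sq_ge0.
by apply: oP; exact: (linear_setB (hardy_linear R)).
Qed.

Let distances := [set norm_infty (csub psi a) | a in @Hinfty R].

Lemma distances_has_inf : has_inf distances.
Proof.
split; last by exists 0 => _ [a _ <-]; exact: norm_infty_ge0.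
exists (norm_infty (csub psi (fun=> 0))), (fun=> 0) => //.
by apply/HinftyP; exact: analytic_cst.
Qed.

Lemma dist_Hinfty_ge0 : 0 <= dist_Hinfty psi.
Proof.
apply: lb_le_inf; first exact: distances_has_inf.1.
by move=> _ [a _ <-]; exact: norm_infty_ge0.
Qed.

Lemma dist_Hinfty_le a (rho : R) : 0 <= rho -> analytic a ->
  {ae m, forall t, sqmod (csub psi a) t <= rho ^+ 2} -> dist_Hinfty psi <= rho.
Proof.
move=> rho0 aa h; apply: le_trans (norm_infty_le rho0 h).
by apply: ge_inf; [exact: distances_has_inf.2|exists a => //; exact/HinftyP].
Qed.

Lemma hankel_dist f : hardy f ->
  sq (mulby psi f - P (mulby psi f)) <= dist_Hinfty psi ^+ 2 * sq f.
Proof.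
move=> Hf; rewrite -!nrm_sqr -exprMn.
rewrite ler_pXn2r ?nnegrE ?mulr_ge0 ?nrm_ge0 ?dist_Hinfty_ge0//.
have [f0|fN] := eqVneq (nrm f) 0.
  have sf : sq f = 0 by rewrite -nrm_sqr f0 expr0n.
  rewrite f0 mulr0 -(sqrtr0 R) ler_wsqrtr//.
  apply: le_trans (hankel_le Hf (hardy_linear R).1) _.
  rewrite subr0 sq_mul_psi.
  have := sq_mul_le f mphi (norm_infty_ae mphi).
  by rewrite sf mulr0.
have fp : 0 < nrm f by rewrite lt_def fN nrm_ge0.
rewrite -ler_pdivrMr//; apply: lb_le_inf; first exact: distances_has_inf.1.
move=> _ [a /HinftyP aa <-]; rewrite ler_pdivrMr//.
have ma : multiplier a := aa.1.
rewrite -(@ler_pXn2r _ 2)// ?nnegrE ?mulr_ge0 ?nrm_ge0 ?norm_infty_ge0//.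
rewrite exprMn !nrm_sqr; apply: le_trans (hankel_le Hf (analytic_mul aa Hf)) _.
rewrite -mulby_sub//; apply: sq_mul_le; first exact: multiplierB.
exact: norm_infty_ae (multiplierB _ _).
Qed.

Lemma toeplitz_lower f (c : R) : hardy f -> sq f = 1 ->
  {ae m, forall t, c ^+ 2 <= sqmod phi t} ->
  c ^+ 2 - dist_Hinfty psi ^+ 2 <= sq (P (mulby psi f)).
Proof.
move=> Hf f1 phic; have := sq_split (mulby psi f); have := hankel_dist Hf.
have := sq_mul_ge f mphi phic; rewrite sq_mul_psi f1 !mulr1; lra.
Qed.

Lemma hankel_of_lower (s : R) : {ae m, forall t, sqmod phi t = 1} -> 0 <= s <= 1 ->
  (forall f, modelV u f -> sq f = 1 -> s ^+ 2 <= sq (P (mulby psi f))) ->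
  hankel_bound psi (Num.sqrt (1 - s ^+ 2)).
Proof.
move=> phi1 /andP[s0 s1] H F G HF HG.
have s2 : 0 <= 1 - s ^+ 2 by rewrite subr_ge0 exprn_ile1.
rewrite sqr_sqrtr//.
(* u g is the component of F in u H^2. Multiplied by psi it becomes phi g, which pairs to zero with
   [cohardy], so only the component f in the model space is felt by the form. *)
have [HPF oPF] := PP (mulby (cconj u) F); set g := P _ in HPF oPF.
pose f := F - mulby u g.
have Mf : modelV u f.
  split; first by apply: (linear_setB (hardy_linear R)) => //; exact: analytic_mul.
  move=> h Hh; rewrite /f ipBl inner_isometry.
  by rewrite -(conjcK (ip F _)) (ipC ip) mulby_adj// (ipC ip) -ipBl oPF.
have FE : F = f + mulby u g by rewrite subrK.
have sqF : sq F = sq f + sq (mulby u g).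
  by rewrite {1}FE sq_orthogonal//; apply: Mf.2.
have -> : ip (mulby psi F) G = ip (mulby psi f) G.
  rewrite FE mulbyD// ipDl -[mulby psi (mulby u g)](subrK (mulby phi g)) ipDl.
  rewrite (sq_null_ip _ (mulby_psi_inner g)) (hardy_cohardy (analytic_mul aphi HPF) HG).
  by rewrite !addr0.
have [HP oP] := PP (mulby psi f).
have -> : ip (mulby psi f) G = ip (mulby psi f - P (mulby psi f)) G.
  by rewrite ipBl (hardy_cohardy HP HG) subr0.
apply: le_trans (cauchy_schwarz _ _ _) _; rewrite ler_wpM2r ?sq_ge0//.
have isoF : sq (mulby psi f) = sq f by rewrite sq_mul_psi sq_mul_unimodular.
have lower : s ^+ 2 * sq f <= sq (P (mulby psi f)).
  have [f0|fN] := eqVneq (sq f) 0; first by rewrite f0 mulr0 sq_ge0.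
  have fp : 0 < sq f by rewrite lt_def fN sq_ge0.
  pose c := (nrm f)^-1.
  have c2 : c ^+ 2 = (sq f)^-1 by rewrite exprVn nrm_sqr.
  have := H (c%:C *: f) (linear_setZ _ modelV_linear Mf).
  rewrite sqZ nsqR c2 mulVf// => /(_ erefl).
  (* [P] commutes with scalars only up to null vectors, which is all that the seminorm sees. *)
  rewrite mulbyZ// (@P_unique _ (c%:C *: P (mulby psi f))).
  - by rewrite sqZ nsqR c2 mulrC ler_pdivlMr.
  - exact: (linear_setZ _ (hardy_linear R)).
  - by move=> h Hh; rewrite -scalerBr ipZl oP// mulr0.
have := sq_split (mulby psi f); rewrite isoF => e1.
apply: (@le_trans _ _ ((1 - s ^+ 2) * sq f)); first by rewrite mulrBl mul1r; lra.
by rewrite ler_wpM2l// sqF lerDl sq_ge0.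
Qed.

End model.

(** * Minimum modulus and assembly of the theorem *)

Lemma minmod_le (R : realType) (D D' : set (cfun R)) A : D `<=` D' ->
  (exists2 f, D f & norm2 f = 1) -> minmod D' A <= minmod D A.
Proof.
move=> DD' [f Df f1]; apply: lb_le_inf; first by exists (norm2 (A f)), f.
move=> _ [g [Dg g1] <-]; apply: ge_inf.
  by exists 0 => _ [h _ <-]; exact: norm2_ge0.
by exists g => //; split => //; exact: DD'.
Qed.

Lemma minmod_ge (R : realType) (D : set (cfun R)) A (c : R) :
  (exists2 f, D f & norm2 f = 1) ->
  (forall f, D f -> norm2 f = 1 -> c <= norm2 (A f)) -> c <= minmod D A.
Proof.
move=> [f Df f1] H; apply: lb_le_inf; first by exists (norm2 (A f)), f.
by move=> _ [g [Dg g1] <-]; exact: H.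
Qed.

Lemma minmod_le_norm (R : realType) (D : set (cfun R)) A f :
  D f -> norm2 f = 1 -> minmod D A <= norm2 (A f).
Proof.
move=> Df f1; apply: ge_inf; last by exists f.
by exists 0 => _ [g _ <-]; exact: norm2_ge0.
Qed.

Lemma minmod_ge0 (R : realType) (D : set (cfun R)) A :
  (exists2 f, D f & norm2 f = 1) -> 0 <= minmod D A.
Proof. by move=> ne; apply: minmod_ge => // f _ _; exact: norm2_ge0. Qed.

Lemma eq_minmod (R : realType) (D : set (cfun R)) A B :
  (forall f, D f -> norm2 (A f) = norm2 (B f)) -> minmod D A = minmod D B.
Proof.
move=> AB; congr inf; apply/seteqP; split=> _ [f [Df f1] <-]; exists f => //.
  by rewrite AB.
by rewrite AB.
Qed.

Theorem theorem5p16 (R : realType) (u phi : cfun R)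
    (u_inner : is_inner_function u) (u_nonconst : nonconstant u)
    (phi_Hinfty : Hinfty phi) :
  let psi := cmul (cconj u) phi in
  let mB := minmod (model_space u) (B_op u phi) in
  [/\ mB = minmod (model_space u) (toeplitz psi) /\
        minmod (model_space u) (toeplitz psi) >=
          minmod (@H2 R) (toeplitz psi),
      mB >= Num.sqrt (essinf_modulus phi ^+ 2 - dist_Hinfty psi ^+ 2)
    & is_inner_function phi -> mB = Num.sqrt (1 - dist_Hinfty psi ^+ 2)].
Proof.
move=> psi mB.
have [au u1] := inner_functionP u_inner.
have aphi : analytic phi by exact/HinftyP.
have mpsi : multiplier psi by apply: multiplierM; [apply: multiplier_conj; case: au|case: aphi].
have [P PP] := hardy_projection R.
have normB f : model_space u f -> norm2 (B_op u phi f) = nrm (l2 R) (P (mulby psi (toL2 f))).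
  exact: norm2_B_op.
have spaceP f : model_space u f -> norm2 f = 1 -> modelV u (toL2 f) /\ sq (l2 R) (toL2 f) = 1.
  move=> /(model_spaceP _ au.1)[Lf Mf]; rewrite norm2_toL2// => f1.
  by rewrite -nrm_sqr f1 expr1n.
have spaceV f : modelV u f -> sq (l2 R) f = 1 ->
    model_space u (L2val f) /\ norm2 (L2val f) = 1.
  move=> Mf f1; split; last by rewrite norm2_nrm /nrm f1 sqrtr1.
  by apply/(model_spaceP _ au.1); rewrite toL2val; split => //; exact: L2val_L2.
have ne : exists2 f, model_space u f & norm2 f = 1.
  have [f Mf f1] := model_unit_vector au u1 u_nonconst.
  by have [h1 h2] := spaceV f Mf f1; exists (L2val f : cfun R).
(* A general c serves twice: the essential infimum gives (2), and c = 1 gives one half of the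
   equality for inner [phi]. *)
have lower (c : R) : {ae circle_measure R, forall t, c ^+ 2 <= sqmod phi t} ->
    Num.sqrt (c ^+ 2 - dist_Hinfty psi ^+ 2) <= mB.
  move=> phic; apply: minmod_ge => // f Df f1; rewrite normB// ler_wsqrtr//.
  have [[Hf _] sf1] := spaceP f Df f1.
  exact: (toeplitz_lower au u1 aphi PP).
split.
- split; last by apply: minmod_le => // f [].
  apply: eq_minmod => f Df; rewrite normB// (norm2_toeplitz au aphi PP)//.
  by case: Df.
- exact/lower/essinf_modulus_ae.
- move=> /inner_functionP[_ phi1]; apply/eqP; rewrite eq_le; apply/andP; split; last first.
    have := lower 1; rewrite expr1n; apply; apply: filterS phi1 => t ->.
    exact: lexx.
  have mB0 : 0 <= mB by exact: minmod_ge0.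
  have mBle f : modelV u f -> sq (l2 R) f = 1 -> mB ^+ 2 <= sq (l2 R) (P (mulby psi f)).
    move=> Mf f1; have [Df Nf] := spaceV f Mf f1.
    rewrite -nrm_sqr ler_pXn2r ?nnegrE ?nrm_ge0//.
    by rewrite -{1}(toL2val f) -normB//; exact: minmod_le_norm.
  (* Multiplication by psi preserves norms and [P] does not increase them, so any unit vector of the
     model space bounds [mB] by 1; thus 1 - mB^2 is a legitimate squared Hankel bound. *)
  have mB1 : mB <= 1.
    have [f Mf f1] := model_unit_vector au u1 u_nonconst.
    rewrite -(@ler_pXn2r _ 2)// ?nnegrE// expr1n.
    apply: le_trans (mBle f Mf f1) _.
    rewrite -f1 -(sq_mul_unimodular f aphi.1 phi1) -(sq_mul_psi au u1 aphi).
    by rewrite [leRHS](sq_split PP) lerDl sq_ge0.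
  have hb := hankel_of_lower au u1 aphi PP phi1 (introT andP (conj mB0 mB1)) mBle.
  have [h ah hle] := nehari mpsi (sqrtr_ge0 _) hb.
  have s2 : 0 <= 1 - mB ^+ 2 by rewrite subr_ge0 exprn_ile1.
  have := dist_Hinfty_le (sqrtr_ge0 _) ah hle.
  have d0 := dist_Hinfty_ge0 u phi.
  rewrite -(@ler_pXn2r _ 2)// ?nnegrE ?sqrtr_ge0// sqr_sqrtr// => dle.
  (* The estimate dist^2 <= 1 - mB^2 is the claim after squaring, and it also shows that the number
     under the root is nonnegative. *)
  rewrite -(@ler_pXn2r _ 2)// ?nnegrE ?sqrtr_ge0// sqr_sqrtr; first lra.
  move: dle (sqr_ge0 mB); rewrite -/psi; lra.
Qed.
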